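(* Let $\mathcal N$ and $\mathcal M$ be quantum channels on $n$-qubit operators that both satisfy $s$-detailed balance with respect to $\rho_\beta$ (for some fixed $s\in[0,1]$), such that $\mathcal N$ has $\rho_\beta$ as its unique fixed state and the spectrum of $\mathcal N$ lies in $[0,1]$. Suppose moreover that the linear map $\widehat{\mathcal M}$ also satisfies $s$-detailed balance with respect to $\rho_\beta$, and that $\mathbb V_{\rho_\beta}(\mathcal M)>0$. Let $\rho$ be an arbitrary initial state, let $\epsilon,\eta>0$, set $T_{burn}:=t_{mix}(\eta)$, and let $K$ be an integer with $$K\ \ge\ \frac{2\,\mathbb V_{\rho_\beta}(\mathcal M)}{\epsilon^2\eta}\left(\frac{\mathbf p}{\mathrm{gap}(\mathcal N)}+\frac12\right),\qquad \mathbf p:=\frac{\mathrm{Cov}_{\rho_\beta}(\mathcal M)}{\mathbb V_{\rho_\beta}(\mathcal M)}.$$ Then the outcomes $e_1,\dots,e_K$ of the single-trajectory algorithm run with inputs $\mathcal N,\mathcal M,\rho,T_{burn},K$ satisfy $$\Pr_\rho\left(\left|\frac1K\sum_{t=1}^K e_t-\mathbb E_{\rho_\beta}(\mathcal M)\right|\ge \epsilon\right)\le 2\eta .$$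
   Context: Let $H$ be a Hermitian operator on $n$ qubits, $\beta>0$, and $\rho_\beta=e^{-\beta H}/\operatorname{tr}(e^{-\beta H})$ (a positive definite density matrix). A quantum channel is a completely positive trace-preserving map $\mathcal T(X)=\sum_u K_uXK_u^\dagger$; its dual (Heisenberg picture) is $\mathcal T^\dagger(X)=\sum_uK_u^\dagger XK_u$, which is the adjoint w.r.t. $\langle A,B\rangle=\operatorname{tr}(A^\dagger B)$; for a general linear map on matrices, $\mathcal T^\dagger$ denotes its Hilbert–Schmidt adjoint. For $s\in[0,1]$ define $\langle A,B\rangle_s=\operatorname{tr}(A^\dagger\rho_\beta^{1-s}B\rho_\beta^{s})$. A linear map $\mathcal T$ satisfies $s$-detailed balance w.r.t. $\rho_\beta$ if $\langle A,\mathcal T^\dagger(B)\rangle_s=\langle\mathcal T^\dagger(A),B\rangle_s$ for all $A,B$. The spectrum of a map is its set of eigenvalues as a linear map on matrices. For a channel $\mathcal T$ satisfying $s$-detailed balance, $\mathrm{gap}(\mathcal T):=1-\max_{X\neq0,\ \langle X,I\rangle_s=0}\langle X,\mathcal T^\dagger(X)\rangle_s/\langle X,X\rangle_s$. Measurements: $\mathcal M$ has Kraus operators $\{O_u\}_u$ indexed by a finite set of real numbers $u$ (the outcomes); applied to $\rho$ it gives outcome $u$ with probability $\operatorname{tr}(O_u\rho O_u^\dagger)$ and post-measurement state proportional to $O_u\rho O_u^\dagger$. $\mathbb E_{\rho}(\mathcal M)=\sum_u u\operatorname{tr}(O_u\rho O_u^\dagger)$, $\mathbb V_{\rho}(\mathcal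 M)=\sum_u|u-\mathbb E_\rho(\mathcal M)|^2\operatorname{tr}(O_u\rho O_u^\dagger)$, $\mathrm{Cov}_\rho(\mathcal M)=\sum_{x,y}(x-\mathbb E_\rho(\mathcal M))(y-\mathbb E_\rho(\mathcal M))\operatorname{tr}(O_yO_x\rho O_x^\dagger O_y^\dagger)$. Define the linear map $\widehat{\mathcal M}(X)=\sum_u(u-\mathbb E_{\rho_\beta}(\mathcal M))O_uXO_u^\dagger$. Mixing time: $t_{mix}(\eta)=\min\{t\in\mathbb N:\|\mathcal N^t(\sigma)-\rho_\beta\|_1\le\eta\ \text{for all states }\sigma\}$. Single-trajectory algorithm with inputs $\mathcal N,\mathcal M$, initial state $\rho$, integers $T_{burn},K$: apply $\mathcal N$ $T_{burn}$ times to $\rho$; then for $t=1,\dots,K$ apply $\mathcal M$ (record its outcome as $e_t$), then $\mathcal N$, then $\mathcal M$ again (its outcome discarded); i.e. each round applies $\mathcal M\circ\mathcal N\circ\mathcal M$ and $e_t$ is the outcome of the first (rightmost) $\mathcal M$. $\Pr_\rho$ denotes probability over all measurement outcomes of this process started from $\rho$. *)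

(* Defs.v *)
From mathcomp Require Import all_boot all_order all_algebra.
From mathcomp Require Import all_classical all_reals all_analysis.
From mathcomp Require Import complex.

Set Implicit Arguments.
Unset Strict Implicit.
Unset Printing Implicit Defensive.

Import Order.TTheory GRing.Theory Num.Theory.
Local Open Scope ring_scope.

Definition adj (R : realType) (p q : nat) (A : 'M[R[i]]_(p, q)) : 'M[R[i]]_(q, p) :=
  (map_mx Num.conj A)^T.

Definition herm_mx (R : realType) (N : nat) (A : 'M[R[i]]_N) : Prop := adj A = A.

Definition unitary_mx (R : realType) (N : nat) (U : 'M[R[i]]_N) : Prop :=
  adj U *m U = 1%:M.

Definition diagR (R : realType) (N : nat) (d : 'I_N -> R) : 'M[R[i]]_N :=
  diag_mx (\row_i ((d i)%:C)%C).

Definition psd (R : realType) (N : nat) (A : 'M[R[i]]_N) : Prop :=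
  forall v : 'cV[R[i]]_N, 0 <= (adj v *m A *m v) 0 0.

Definition is_state (R : realType) (N : nat) (A : 'M[R[i]]_N) : Prop :=
  psd A /\ \tr A = 1.

(* f(H) for H = U diag(lam) U^*, U unitary_mx *)
Definition fcalc (R : realType) (N : nat) (U : 'M[R[i]]_N) (lam : 'I_N -> R)
  (f : R -> R) : 'M[R[i]]_N :=
  U *m diagR (fun i => f (lam i)) *m adj U.

Definition partfun (R : realType) (N : nat) (beta : R) (lam : 'I_N -> R) : R :=
  \sum_i expR (- (beta * lam i)).

Definition gibbs (R : realType) (N : nat) (beta : R) (U : 'M[R[i]]_N)
  (lam : 'I_N -> R) : 'M[R[i]]_N :=
  (\tr (fcalc U lam (fun x => expR (- (beta * x)))))^-1 *:
     fcalc U lam (fun x => expR (- (beta * x))).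

(* rho_beta ^ p (p real), by functional calculus: the eigenvalues of rho_beta
   are exp(-beta lam_i)/Z > 0 *)
Definition gibbs_pow (R : realType) (N : nat) (beta : R) (U : 'M[R[i]]_N)
  (lam : 'I_N -> R) (p : R) : 'M[R[i]]_N :=
  fcalc U lam (fun x => (expR (- (beta * x)) / partfun beta lam) `^ p).

Definition ip_s (R : realType) (N : nat) (beta : R) (U : 'M[R[i]]_N)
  (lam : 'I_N -> R) (s : R) (A B : 'M[R[i]]_N) : R[i] :=
  \tr (adj A *m gibbs_pow beta U lam (1 - s) *m B *m gibbs_pow beta U lam s).

(* s-detailed balance of a linear map, given through its Hilbert-Schmidt
   adjoint Tdual *)
Definition detailed_balance (R : realType) (N : nat) (beta : R) (U : 'M[R[i]]_N)
  (lam : 'I_N -> R) (s : R) (Tdual : 'M[R[i]]_N -> 'M[R[i]]_N) : Prop :=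
  forall A B : 'M[R[i]]_N,
    ip_s beta U lam s A (Tdual B) = ip_s beta U lam s (Tdual A) B.

Definition kraus_map (R : realType) (N k : nat) (K : 'I_k -> 'M[R[i]]_N)
  (X : 'M[R[i]]_N) : 'M[R[i]]_N :=
  \sum_(u < k) K u *m X *m adj (K u).

Definition kraus_dual (R : realType) (N k : nat) (K : 'I_k -> 'M[R[i]]_N)
  (X : 'M[R[i]]_N) : 'M[R[i]]_N :=
  \sum_(u < k) adj (K u) *m X *m K u.

Definition is_channel (R : realType) (N k : nat) (K : 'I_k -> 'M[R[i]]_N) : Prop :=
  \sum_(u < k) adj (K u) *m K u = 1%:M.

Definition is_measurement (R : realType) (N m : nat) (val : 'I_m -> R)
  (O : 'I_m -> 'M[R[i]]_N) : Prop :=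
  injective val /\ is_channel O.

Definition eigenvalue_of (R : realType) (N : nat) (T : 'M[R[i]]_N -> 'M[R[i]]_N)
  (z : R[i]) : Prop :=
  exists2 X : 'M[R[i]]_N, X != 0 & T X = z *: X.

(* spectrum contained in [0,1] (in C: real and between 0 and 1) *)
Definition spectrum_in_01 (R : realType) (N : nat)
  (T : 'M[R[i]]_N -> 'M[R[i]]_N) : Prop :=
  forall z : R[i], eigenvalue_of T z -> 0 <= z <= 1.

Definition unique_fixed_state (R : realType) (N : nat)
  (T : 'M[R[i]]_N -> 'M[R[i]]_N) (rho : 'M[R[i]]_N) : Prop :=
  is_state rho /\ T rho = rho /\
  forall sigma, is_state sigma -> T sigma = sigma -> sigma = rho.

(* gap(T) = 1 - max_{X<>0, <X,I>_s = 0} <X,T^dag X>_s / <X,X>_s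
   (the quotient is real under detailed balance; the max is a sup of a
   set attaining it) *)
Definition gap (R : realType) (N : nat) (beta : R) (U : 'M[R[i]]_N)
  (lam : 'I_N -> R) (s : R) (Tdual : 'M[R[i]]_N -> 'M[R[i]]_N) : R :=
  1 - sup [set r : R | exists X : 'M[R[i]]_N,
        X != 0 /\ ip_s beta U lam s X 1%:M = 0 /\
        r = complex.Re (ip_s beta U lam s X (Tdual X) / ip_s beta U lam s X X)].

(* trace norm = sum of singular values, A = V diag(d) W with V, W unitary_mx,
   d >= 0 (all such decompositions give the same sum) *)
Definition trnorm (R : realType) (N : nat) (A : 'M[R[i]]_N) : R :=
  sup [set r : R | exists (V W : 'M[R[i]]_N) (d : 'I_N -> R),
        [/\ unitary_mx V, unitary_mx W, (forall i, 0 <= d i),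
            A = V *m diagR d *m W & r = \sum_i d i]].

Definition mixed_at (R : realType) (N : nat) (T : 'M[R[i]]_N -> 'M[R[i]]_N)
  (rho : 'M[R[i]]_N) (eta : R) (t : nat) : Prop :=
  forall sigma, is_state sigma -> trnorm (iter t T sigma - rho) <= eta.

Definition is_tmix (R : realType) (N : nat) (T : 'M[R[i]]_N -> 'M[R[i]]_N)
  (rho : 'M[R[i]]_N) (eta : R) (t : nat) : Prop :=
  mixed_at T rho eta t /\ forall t', mixed_at T rho eta t' -> (t <= t')%N.

Definition outcome_prob (R : realType) (N m : nat) (O : 'I_m -> 'M[R[i]]_N)
  (rho : 'M[R[i]]_N) (x : 'I_m) : R :=
  complex.Re (\tr (O x *m rho *m adj (O x))).

Definition meas_mean (R : realType) (N m : nat) (val : 'I_m -> R)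
  (O : 'I_m -> 'M[R[i]]_N) (rho : 'M[R[i]]_N) : R :=
  \sum_x val x * outcome_prob O rho x.

Definition meas_var (R : realType) (N m : nat) (val : 'I_m -> R)
  (O : 'I_m -> 'M[R[i]]_N) (rho : 'M[R[i]]_N) : R :=
  \sum_x `|val x - meas_mean val O rho| ^+ 2 * outcome_prob O rho x.

Definition meas_cov (R : realType) (N m : nat) (val : 'I_m -> R)
  (O : 'I_m -> 'M[R[i]]_N) (rho : 'M[R[i]]_N) : R :=
  \sum_x \sum_y (val x - meas_mean val O rho) * (val y - meas_mean val O rho) *
     complex.Re (\tr (O y *m O x *m rho *m adj (O x) *m adj (O y))).

Definition hat_map (R : realType) (N m : nat) (val : 'I_m -> R)
  (O : 'I_m -> 'M[R[i]]_N) (rho : 'M[R[i]]_N) (X : 'M[R[i]]_N) : 'M[R[i]]_N :=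
  \sum_x ((val x - meas_mean val O rho)%:C)%C *: (O x *m X *m adj (O x)).

Definition hat_dual (R : realType) (N m : nat) (val : 'I_m -> R)
  (O : 'I_m -> 'M[R[i]]_N) (rho : 'M[R[i]]_N) (X : 'M[R[i]]_N) : 'M[R[i]]_N :=
  \sum_x (((val x - meas_mean val O rho)%:C)%C)^* *: (adj (O x) *m X *m O x).

(* one round M o N o M, first measurement recorded with outcome x, second
   measurement's outcome y summed over (discarded); unnormalized state *)
Definition round_step (R : realType) (N k m : nat) (NK : 'I_k -> 'M[R[i]]_N)
  (O : 'I_m -> 'M[R[i]]_N) (x : 'I_m) (sigma : 'M[R[i]]_N) : 'M[R[i]]_N :=
  \sum_(y < m) O y *m kraus_map NK (O x *m sigma *m adj (O x)) *m adj (O y).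

Definition run_rounds (R : realType) (N k m : nat) (NK : 'I_k -> 'M[R[i]]_N)
  (O : 'I_m -> 'M[R[i]]_N) (xs : seq 'I_m) (sigma : 'M[R[i]]_N) : 'M[R[i]]_N :=
  foldl (fun st x => round_step NK O x st) sigma xs.

(* Pr_rho( | (1/K) sum_t e_t - mu | >= eps ) for the algorithm with
   T_burn burn-in applications of N and K rounds; a run is the sequence
   f : 'I_K -> outcome indices, with probability tr of the final
   unnormalized state *)
Definition alg_dev_prob (R : realType) (N k m : nat) (NK : 'I_k -> 'M[R[i]]_N)
  (val : 'I_m -> R) (O : 'I_m -> 'M[R[i]]_N) (rho : 'M[R[i]]_N)
  (Tburn K : nat) (mu eps : R) : R :=
  \sum_(f : {ffun 'I_K -> 'I_m} |
          eps <= `| (K%:R)^-1 * (\sum_(t < K) val (f t)) - mu |)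
     complex.Re (\tr (run_rounds NK O [seq f t | t <- enum 'I_K]
                        (iter Tburn (kraus_map NK) rho))).

(* Main.v *)
(* Chebyshev's inequality for the stationary process, plus a trace-norm
   comparison between the burnt-in state and rho_beta.

   Detailed balance says that G(X) = rho^(1-s) X rho^s intertwines a map with its
   dual, and that the dual is self-adjoint for <A, B>_s = tr (A^* G(B)).  Write A
   for the dual of the centered measurement map applied to 1, so that the centered
   measurement map sends rho to G(A), A is orthogonal to 1 and <A, A>_s is the
   covariance Cov.  In the stationary process the covariance of two outcomes that
   are j + 1 rounds apart is <A, (M N M)^j M N A>_s with M and N the dual channels.
   M is a contraction because it is self-adjoint with spectrum in [-1, 1]
   (Kadison-Schwarz), and N contracts the orthogonal complement of 1 by the factor
   1 - gap; uniqueness of the fixed state makes the gap positive.  Summing the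
   geometric series, the second moment of the centered sum of K outcomes is at
   most K (V + 2 Cov / gap), and Chebyshev bounds the stationary deviation
   probability by eta.

   The deviation probability is a linear functional of the state with values
   between 0 and the trace on positive matrices; the spectral decomposition of the
   difference of two states shows that it changes by at most their trace distance,
   which is at most eta after the burn-in. *)
Require Import Defs.
From mathcomp Require Import all_boot all_order all_algebra.
From mathcomp Require Import all_classical all_reals all_analysis.
From mathcomp Require Import complex.
From mathcomp Require Import ring lra.
Import Order.TTheory GRing.Theory Num.Theory.
Local Open Scope ring_scope.

Set Implicit Arguments.
Unset Strict Implicit.
Unset Printing Implicit Defensive.

(** * Adjoints, positive semidefinite matrices and the spectral theorem *)

Section Adjoint.
Variable C : numClosedFieldType.

(* Convertible at [C := R[i]] to [adj] and [psd] of Defs. *)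
Definition hadj p q (A : 'M[C]_(p, q)) : 'M[C]_(q, p) := (map_mx Num.conj A)^T.

Definition hpsd p (A : 'M[C]_p) :=
  forall v : 'cV[C]_p, 0 <= (hadj v *m A *m v) 0 0.

Lemma hadjE p q (A : 'M[C]_(p, q)) i j : hadj A i j = (A j i)^*.
Proof. by rewrite !mxE. Qed.

Lemma hadjK p q (A : 'M[C]_(p, q)) : hadj (hadj A) = A.
Proof. by apply/matrixP=> i j; rewrite !hadjE conjCK. Qed.

Lemma hadjM p q r (A : 'M[C]_(p, q)) (B : 'M[C]_(q, r)) :
  hadj (A *m B) = hadj B *m hadj A.
Proof. by rewrite /hadj map_mxM trmx_mul. Qed.

Lemma hadjD p q (A B : 'M[C]_(p, q)) : hadj (A + B) = hadj A + hadj B.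
Proof. by rewrite /hadj map_mxD linearD. Qed.

Lemma hadjB p q (A B : 'M[C]_(p, q)) : hadj (A - B) = hadj A - hadj B.
Proof. by rewrite /hadj map_mxB linearB. Qed.

Lemma hadjZ p q (a : C) (A : 'M[C]_(p, q)) : hadj (a *: A) = a^* *: hadj A.
Proof. by rewrite /hadj map_mxZ linearZ. Qed.

Lemma hadj1 p : hadj 1%:M = 1%:M :> 'M[C]_p.
Proof. by rewrite /hadj map_mx1 trmx1. Qed.

Lemma hadj_sum p q (I : Type) (r : seq I) (F : I -> 'M[C]_(p, q)) :
  hadj (\sum_(i <- r) F i) = \sum_(i <- r) hadj (F i).
Proof.
apply/matrixP => i j; rewrite hadjE !summxE rmorph_sum.
by apply: eq_bigr => k _; rewrite hadjE.
Qed.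

Lemma hadj_tr p (A : 'M[C]_p) : \tr (hadj A) = (\tr A)^*.
Proof.
rewrite /mxtrace rmorph_sum; apply: eq_bigr => i _; exact: hadjE.
Qed.

Lemma hadj_inv p (A : 'M[C]_p) : hadj (invmx A) = invmx (hadj A).
Proof. by rewrite /hadj map_invmx trmx_inv. Qed.

Lemma hadj_delta p q (i : 'I_p) (j : 'I_q) :
  hadj (delta_mx i j) = delta_mx j i :> 'M[C]_(q, p).
Proof. by apply/matrixP => a b; rewrite hadjE !mxE conjC_nat andbC. Qed.

Lemma delta_sandwich p (A : 'M[C]_p) i j :
  (delta_mx 0 i *m A *m delta_mx j 0 : 'M[C]_1) 0 0 = A i j.
Proof. by rewrite -mulmxA -colE -rowE !mxE. Qed.

Lemma hpsd_congr p (A : 'M[C]_p) q (X : 'M[C]_(q, p)) :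
  hpsd A -> hpsd (X *m A *m hadj X).
Proof.
move=> pA v; have := pA (hadj X *m v).
by rewrite hadjM hadjK !mulmxA.
Qed.

Lemma hpsdD p (A B : 'M[C]_p) : hpsd A -> hpsd B -> hpsd (A + B).
Proof. by move=> pA pB v; rewrite mulmxDr mulmxDl mxE addr_ge0. Qed.

Lemma hpsd0 p : hpsd (0 : 'M[C]_p).
Proof. by move=> v; rewrite mulmx0 mul0mx mxE. Qed.

Lemma hpsdZ p (a : C) (A : 'M[C]_p) : 0 <= a -> hpsd A -> hpsd (a *: A).
Proof. by move=> a0 pA v; rewrite -scalemxAr -scalemxAl mxE mulr_ge0. Qed.

Lemma hpsd_sum p (I : finType) (P : pred I) (F : I -> 'M[C]_p) :
  (forall i, P i -> hpsd (F i)) -> hpsd (\sum_(i | P i) F i).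
Proof.
move=> pF; apply: (big_ind (@hpsd p)) => //; [exact: hpsd0|exact: hpsdD].
Qed.

Lemma hpsd_diag p (d : 'rV[C]_p) : (forall i, 0 <= d 0 i) -> hpsd (diag_mx d).
Proof.
move=> d0 v; rewrite -mulmxA mxE; apply: sumr_ge0 => i _.
by rewrite mul_diag_mx mxE hadjE mulrCA mulr_ge0 // mulrC mul_conjC_ge0.
Qed.

Lemma hpsd_gram p q (X : 'M[C]_(p, q)) : hpsd (hadj X *m X).
Proof.
move=> w; rewrite !mulmxA -mulmxA -hadjM mxE; apply: sumr_ge0 => i _.
by rewrite hadjE mulrC mul_conjC_ge0.
Qed.

Lemma hpsd_tr_ge0 p (A : 'M[C]_p) : hpsd A -> 0 <= \tr A.
Proof.
move=> pA; apply: sumr_ge0 => i _.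
by have := pA (delta_mx i 0); rewrite hadj_delta delta_sandwich.
Qed.

(** Polarization: the form [f] is real on the diagonal. At [x + y] this equates the imaginary parts
    of [f x y] and of the conjugate of [f y x], and at [x + 'i *: y] the real parts. *)
Lemma hpsd_herm p (A : 'M[C]_p) : hpsd A -> hadj A = A.
Proof.
move=> pA; set f := fun x y : 'cV[C]_p => (hadj x *m A *m y) 0 0.
have fr x : (f x x)^* = f x x by apply: geC0_conj; exact: pA.
have fD x y : f (x + y) (x + y) = f x x + f x y + (f y x + f y y).
  by rewrite /f hadjD !mulmxDl !mulmxDr !mxE.
have fi x y : f (x + 'i *: y) (x + 'i *: y)
    = f x x + 'i * f x y + (- ('i * f y x) + f y y).
  rewrite fD /f hadjZ conjCi -!scalemxAr -!scalemxAl !mxE.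
  by rewrite !mulNr mulrN mulrA -expr2 sqrCi mulN1r opprK.
have key x y : (f x y)^* = f y x.
  have := fr (x + y); rewrite fD !rmorphD /= !fr !addrA => /addIr.
  rewrite -!addrA => /addrI e1.
  have := fr (x + 'i *: y).
  rewrite fi !rmorphD rmorphN !rmorphM /= conjCi !fr !addrA => /addIr.
  rewrite -!addrA !mulNr opprK -mulrN -!mulrDr => /addrI.
  rewrite -!mulrBr => /(mulfI (neq0Ci _)) e2.
  apply: (mulfI (x := 2)); first by rewrite pnatr_eq0.
  transitivity ((f x y)^* + (f y x)^* - (- (f x y)^* + (f y x)^* )).
    by rewrite opprD opprK addrACA subrr addr0 mulr_natl mulr2n.
  by rewrite e1 e2 opprD opprK addrACA subrr add0r mulr_natl mulr2n.
apply/matrixP => i j; rewrite hadjE.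
by have := key (delta_mx j 0) (delta_mx i 0); rewrite /f !hadj_delta !delta_sandwich.
Qed.

Lemma herm_spectral p (A : 'M[C]_p) : hadj A = A ->
  exists (V : 'M[C]_p) (d : 'rV[C]_p),
    [/\ hadj V *m V = 1%:M, V *m hadj V = 1%:M,
        forall i, d 0 i \is Num.real & A = V *m diag_mx d *m hadj V].
Proof.
move=> hA; have Ah : A \is hermsymmx.
  by apply/is_hermitianmxP; rewrite expr0 scale1r -[LHS]hA /hadj map_trmx.
have /hermitian_normalmx /orthomx_spectralP eA := Ah.
have uP := spectral_unitarymx A.
have iP : invmx (spectralmx A) = hadj (spectralmx A).
  by rewrite invmx_unitary // /hadj map_trmx.
exists (hadj (spectralmx A)), (spectral_diag A).
rewrite hadjK -iP mulmxV ?spectral_unit // mulVmx ?spectral_unit //.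
split=> // i; by have /mxOverP/(_ 0 i) := hermitian_spectral_diag_real Ah.
Qed.

End Adjoint.
Lemma mxtrace_sum (C : numClosedFieldType) N (I : finType) (F : I -> 'M[C]_N) :
  \tr (\sum_i F i) = \sum_i \tr (F i).
Proof. exact: raddf_sum. Qed.

(** * The weighted inner product and its self-adjoint maps *)

Section WeightedInnerProduct.
Variables (C : numClosedFieldType) (N : nat) (Lh Rh : 'M[C]_N).
Hypotheses (hL : hadj Lh = Lh) (hR : hadj Rh = Rh).
Hypotheses (uL : Lh \in unitmx) (uR : Rh \in unitmx).

(* [gam X] is rho^(1-s) X rho^s for [Lh = rho^((1-s)/2)] and [Rh = rho^(s/2)]. *)
Definition gam (X : 'M[C]_N) := Lh *m Lh *m X *m (Rh *m Rh).

(** For the powers of the Gibbs state named above this is [ip_s]. Taking the square roots [Lh] and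
    [Rh] as data makes positivity visible. *)
Definition wip (A B : 'M[C]_N) : C := \tr (hadj A *m gam B).

(** An isometry from [wip] to the standard Hermitian product of row vectors; [unwvec] is its
    inverse. *)
Definition wvec (X : 'M[C]_N) : 'rV[C]_(N * N) := mxvec (Lh *m X *m Rh).

Definition unwvec (r : 'rV[C]_(N * N)) : 'M[C]_N :=
  invmx Lh *m vec_mx r *m invmx Rh.

Lemma unwvecK : cancel unwvec wvec.
Proof.
move=> r; rewrite /wvec /unwvec !mulmxA mulmxV // mul1mx -mulmxA mulVmx //.
by rewrite mulmx1 vec_mxK.
Qed.

Lemma wvecK : cancel wvec unwvec.
Proof.
move=> X; rewrite /wvec /unwvec mxvecK !mulmxA mulVmx // mul1mx.
by rewrite -mulmxA mulmxV // mulmx1.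
Qed.

Lemma dot_mxvec (A B : 'M[C]_N) :
  (mxvec B *m hadj (mxvec A)) 0 0 = \tr (hadj A *m B).
Proof.
rewrite mxE (reindex _ (curry_mxvec_bij _ _)) /=.
transitivity (\sum_i \sum_j (A i j)^* * B i j).
  by rewrite pair_bigA; apply: eq_bigr => -[i j] _; rewrite hadjE !mxvecE mulrC.
rewrite exchange_big; apply: eq_bigr => j _; rewrite mxE.
by apply: eq_bigr => i _; rewrite hadjE.
Qed.

Lemma wipE A B : wip A B = (wvec B *m hadj (wvec A)) 0 0.
Proof.
rewrite dot_mxvec !hadjM hL hR /wip /gam -!mulmxA -[RHS]mxtrace_mulC.
by rewrite -!mulmxA.
Qed.

Lemma wvecD A B : wvec (A + B) = wvec A + wvec B.
Proof. by rewrite /wvec mulmxDr mulmxDl linearD. Qed.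

Lemma wvecZ a A : wvec (a *: A) = a *: wvec A.
Proof. by rewrite /wvec -scalemxAr -scalemxAl linearZ. Qed.

Lemma wipDr A B D : wip A (B + D) = wip A B + wip A D.
Proof. by rewrite !wipE wvecD mulmxDl mxE. Qed.

Lemma wipZr a A B : wip A (a *: B) = a * wip A B.
Proof. by rewrite !wipE wvecZ -scalemxAl mxE. Qed.

Lemma wipC A B : (wip A B)^* = wip B A.
Proof. by rewrite !wipE -hadjE hadjM hadjK. Qed.

Lemma wipDl A B D : wip (B + D) A = wip B A + wip D A.
Proof. by rewrite -wipC wipDr rmorphD /= !wipC. Qed.

Lemma wipZl a A B : wip (a *: B) A = a^* * wip B A.
Proof. by rewrite -wipC wipZr rmorphM /= wipC. Qed.

Lemma wip_ge0 A : 0 <= wip A A.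
Proof.
by rewrite wipE mxE; apply: sumr_ge0 => i _; rewrite hadjE mul_conjC_ge0.
Qed.

Lemma wip_eq0 A : wip A A = 0 -> A = 0.
Proof.
rewrite wipE mxE => /eqP; rewrite psumr_eq0; last first.
  by move=> i _; rewrite hadjE mul_conjC_ge0.
move=> /allP h; rewrite -[A]wvecK (_ : wvec A = 0).
  by rewrite /unwvec linear0 mulmx0 mul0mx.
apply/rowP => i; have := h i (mem_index_enum _).
by rewrite hadjE mul_conjC_eq0 mxE => /eqP.
Qed.

(* Cauchy-Schwarz, stated without square roots. *)
Lemma wip_cauchy A Y r : 0 <= r -> wip Y Y <= r ^+ 2 * wip A A ->
  'Re (wip A Y) <= r * wip A A.
Proof.
(* For [r = 0] the hypothesis forces [Y = 0]. *)
rewrite le_eqVlt => /predU1P[<-|r0] h.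
  rewrite (_ : Y = 0) ?mul0r.
    by rewrite -(scale0r A) wipZr mul0r raddf0.
  by apply/wip_eq0/le_anti; rewrite wip_ge0 andbT (le_trans h) // expr0n mul0r.
have rr : r^* = r by apply: geC0_conj; exact: ltW.
(* Positivity at [r A - Y] bounds twice [r] times the real part by [r^2 a + y], hence by [2 r^2 a];
   then [r] is cancelled. *)
have := wip_ge0 (r *: A + (- 1) *: Y).
rewrite wipDr !wipDl !wipZl !wipZr rmorphN rmorph1 rr -(wipC A Y).
set a := wip A A in h *; set b := wip A Y; set y := wip Y Y in h *.
move=> h0.
have h1 : 0 <= r * (r * a) - r * b - (r * b^* - y).
  suff -> : r * (r * a) - r * b - (r * b^* - y) =
    r * (r * a) + -1 * (r * b^*) + (r * (-1 * b) + -1 * (-1 * y)) by [].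
  by ring.
have {}h1 : r * (b + b^*) <= r * (r * a + r * a).
  rewrite -subr_ge0; apply: (le_trans h1); rewrite -subr_ge0.
  have -> : r * (r * a + r * a) - r * (b + b^*) -
    (r * (r * a) - r * b - (r * b^* - y)) = r ^+ 2 * a - y by ring.
  by rewrite subr_ge0.
move: h1; rewrite ler_pM2l // => h1.
by rewrite ReE ler_pdivrMr ?ltr0n // mulr_natr mulr2n.
Qed.

(** The last clause, Parseval's identity, expresses completeness of the orthonormal system. *)
Definition eigenbasis (T : 'M[C]_N -> 'M[C]_N) (E : 'I_(N * N) -> 'M[C]_N)
    (d : 'I_(N * N) -> C) :=
  [/\ forall k, d k \is Num.real,
      forall k l, wip (E k) (E l) = (k == l)%:R,
      forall k, T (E k) = d k *: E k
    & forall X Y, wip X Y = \sum_k (wip (E k) X)^* * wip (E k) Y].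

(** Self-adjointness already determines the coordinates of [T X] from the images of the basis [e],
    so in the coordinates [wvec] the map is right multiplication by a Hermitian matrix [B], which
    the spectral theorem diagonalizes. *)
Lemma selfadjoint_eigenbasis (T : 'M[C]_N -> 'M[C]_N) :
  (forall A B, wip A (T B) = wip (T A) B) -> exists E d, eigenbasis T E d.
Proof.
move=> saT.
pose e j := unwvec (delta_mx 0 j).
have eE j X : wip (e j) X = wvec X 0 j.
  by rewrite wipE unwvecK hadj_delta -colE mxE.
pose B : 'M[C]_(N * N) := \matrix_(k, j) (wvec (T (e j)) 0 k)^*.
have vT X : wvec (T X) = wvec X *m B.
  apply/rowP => j; rewrite -eE saT wipE !mxE; apply: eq_bigr => k _.
  by rewrite hadjE [B _ _]mxE.
have hB : hadj B = B.
  apply/matrixP => k j; rewrite hadjE !mxE conjCK -!eE wipC.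
  exact: saT.
have [V [d [VV VV' dr eB]]] := herm_spectral hB.
pose E k := unwvec (row k (hadj V)).
have EX k X : wip (E k) X = (wvec X *m V) 0 k.
  rewrite wipE unwvecK; have -> : hadj (row k (hadj V)) = col k V.
    by apply/colP => i; rewrite hadjE !mxE conjCK.
  by rewrite colE mulmxA -colE mxE.
exists E, (fun k => d 0 k); split=> //.
- by move=> k l; rewrite EX unwvecK -row_mul VV !mxE eq_sym.
- move=> k; rewrite -[LHS]wvecK -[RHS]wvecK vT wvecZ unwvecK eB; congr unwvec.
  by rewrite -row_mul !mulmxA VV mul1mx; apply/rowP => j; rewrite mxE mul_diag_mx !mxE.
- move=> X Y; transitivity ((wvec Y *m V *m hadj (wvec X *m V)) 0 0).
    by rewrite hadjM -!mulmxA [V *m _]mulmxA VV' mul1mx wipE.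
  rewrite mxE; apply: eq_bigr => k _.
  by rewrite hadjE !EX mulrC.
Qed.

(** Parseval, term by term. The second alternative discards eigenvectors orthogonal to [X], which is
    how the eigenvalue 1 is later left out. *)
Lemma wip_contract T E d lam X : (forall A B, wip A (T B) = wip (T A) B) ->
  eigenbasis T E d -> (forall k, `|d k| <= lam \/ wip (E k) X = 0) ->
  wip (T X) (T X) <= lam ^+ 2 * wip X X.
Proof.
move=> saT [dr _ TE pars] h; rewrite !pars mulr_sumr; apply: ler_sum => k _.
have -> : wip (E k) (T X) = d k * wip (E k) X.
  by rewrite saT TE wipZl conj_Creal.
rewrite rmorphM mulrACA -!normCKC.
case: (h k) => [hk|->]; last by rewrite normr0 expr0n !mulr0.
apply: ler_wpM2r; first by rewrite exprn_ge0.
by rewrite lerXn2r // nnegrE (le_trans _ hk).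
Qed.


Lemma mxtrace_eq (Y Z : 'M[C]_N) :
  (forall A, \tr (hadj A *m Y) = \tr (hadj A *m Z)) -> Y = Z.
Proof.
move=> h; apply/matrixP => i j; have := h (delta_mx i j).
have trE (W : 'M[C]_N) : \tr (hadj (delta_mx i j) *m W) = W i j.
  rewrite hadj_delta -(mul_delta_mx (0 : 'I_1)) -mulmxA mxtrace_mulC.
  by rewrite /mxtrace big_ord1 delta_sandwich.
by rewrite !trE.
Qed.

(* Detailed balance exchanges the Schrodinger and the Heisenberg picture. *)
Lemma gam_intertwine (T Td : 'M[C]_N -> 'M[C]_N) :
  (forall X Y, \tr (hadj X *m Td Y) = \tr (hadj (T X) *m Y)) ->
  (forall A B, wip A (Td B) = wip (Td A) B) ->
  forall X, T (gam X) = gam (Td X).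
Proof.
move=> dual saT X; apply: mxtrace_eq => A; rewrite -[RHS]/(wip A (Td X)) saT /wip.
have trC (W Z : 'M[C]_N) : \tr (hadj W *m Z) = (\tr (hadj Z *m W))^*.
  by rewrite -hadj_tr hadjM hadjK.
by rewrite trC -dual -trC.
Qed.

End WeightedInnerProduct.

(** * Weighted Kraus maps, Kadison-Schwarz and fixed points *)

Section Kraus.
Variables (C : numClosedFieldType) (N k : nat) (K : 'I_k -> 'M[C]_N).

(** The weights cover three maps at once: 1 gives the channel, the centered outcomes give [hat_map],
    and their squares give the variance. *)
Definition wkraus (a : 'I_k -> C) X := \sum_u a u *: (K u *m X *m hadj (K u)).

Definition wkraus_dual (a : 'I_k -> C) X :=
  \sum_u (a u)^* *: (hadj (K u) *m X *m K u).

Lemma wkraus_dualP a X Y :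
  \tr (hadj X *m wkraus_dual a Y) = \tr (hadj (wkraus a X) *m Y).
Proof.
rewrite hadj_sum mulmx_sumr mulmx_suml !mxtrace_sum; apply: eq_bigr => u _.
rewrite hadjZ -scalemxAr -scalemxAl !mxtraceZ !hadjM hadjK; congr (_ * _).
by rewrite !mulmxA [LHS]mxtrace_mulC !mulmxA.
Qed.

Lemma wkrausD a X Y : wkraus a (X + Y) = wkraus a X + wkraus a Y.
Proof.
rewrite -big_split; apply: eq_bigr => u _.
by rewrite mulmxDr mulmxDl scalerDr.
Qed.

Lemma wkrausZ a c X : wkraus a (c *: X) = c *: wkraus a X.
Proof.
rewrite scaler_sumr; apply: eq_bigr => u _.
by rewrite -scalemxAr -scalemxAl !scalerA mulrC.
Qed.

Lemma wkraus_hadj a X : (forall u, a u \is Num.real) ->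
  wkraus a (hadj X) = hadj (wkraus a X).
Proof.
move=> ar; rewrite hadj_sum; apply: eq_bigr => u _.
by rewrite hadjZ !hadjM hadjK mulmxA conj_Creal.
Qed.

Lemma wkraus_hpsd a X : (forall u, 0 <= a u) -> hpsd X -> hpsd (wkraus a X).
Proof.
by move=> a0 pX; apply: hpsd_sum => u _; apply/hpsdZ/hpsd_congr.
Qed.

Local Notation T := (wkraus (fun=> 1)).
Local Notation Td := (wkraus_dual (fun=> 1)).

Hypothesis chan : \sum_u hadj (K u) *m K u = 1%:M.

Lemma kraus_dual1 : Td 1%:M = 1%:M.
Proof.
by rewrite -[RHS]chan; apply: eq_bigr => u _; rewrite conjC1 scale1r mulmx1.
Qed.

Lemma kraus_tr X : \tr (T X) = \tr X.
Proof.
have := wkraus_dualP (fun=> 1) X 1%:M; rewrite kraus_dual1 !mulmx1 !hadj_tr.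
by move=> /(congr1 Num.conj); rewrite !conjCK.
Qed.

(* The Kadison-Schwarz defect as a sum of squares. *)
Lemma kadison_schwarz E (D := Td E) :
  Td (hadj E *m E) - hadj D *m D =
    \sum_u hadj (E *m K u - K u *m D) *m (E *m K u - K u *m D).
Proof.
have hD : hadj D = \sum_u hadj (K u) *m hadj E *m K u.
  rewrite hadj_sum; apply: eq_bigr => u _.
  by rewrite conjC1 scale1r !hadjM hadjK mulmxA.
have eD : D = \sum_u hadj (K u) *m E *m K u.
  by apply: eq_bigr => u _; rewrite conjC1 scale1r.
(* Up to sign, each of the last three sums is [hadj D *m D], by [chan] and the formula for [D]; two
   of them cancel. *)
transitivity (\sum_u (hadj (K u) *m (hadj E *m E) *m K u -
   hadj (K u) *m hadj E *m K u *m D - hadj D *m (hadj (K u) *m E *m K u) +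
   hadj D *m (hadj (K u) *m K u) *m D)).
  rewrite !big_split /= !sumrN -!mulmx_suml -!mulmx_sumr chan -hD -eD mulmx1.
  rewrite subrK; congr (_ - _); apply: eq_bigr => u _.
  by rewrite conjC1 scale1r.
apply: eq_bigr => u _.
rewrite hadjB !hadjM mulmxBl !mulmxBr !mulmxA opprB.
by rewrite addrA addrAC.
Qed.

(* Kadison-Schwarz at an eigenvector, tested against the faithful invariant
   state [Q *m Q]. *)
Lemma kraus_dual_eigen_le1 (Q E : 'M[C]_N) d : hadj Q = Q -> Q \in unitmx ->
  T (Q *m Q) = Q *m Q -> E != 0 -> Td E = d *: E -> `|d| <= 1.
Proof.
move=> hQ uQ fixQ E0 TE.
pose g := \tr (hadj (E *m Q) *m (E *m Q)).
have trQ (X : 'M[C]_N) : \tr (hadj Q *m X *m Q) = \tr (hadj (Q *m Q) *m X).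
  by rewrite mxtrace_mulC !mulmxA hadjM hQ.
have g1 : \tr (hadj Q *m Td (hadj E *m E) *m Q) = g.
  rewrite trQ wkraus_dualP fixQ -trQ /g hadjM !mulmxA //.
have g2 : \tr (hadj Q *m (hadj (Td E) *m Td E) *m Q) = `|d| ^+ 2 * g.
  rewrite TE hadjZ -scalemxAl -!scalemxAr -!scalemxAl !mxtraceZ mulrA -normCKC.
  by rewrite /g hadjM !mulmxA.
have g0 : 0 < g.
  have gE : g = \sum_j \sum_i `|(E *m Q) i j| ^+ 2.
    by apply: eq_bigr => j _; rewrite mxE; apply: eq_bigr => i _; rewrite hadjE normCKC.
  have EQ0 : E *m Q != 0.
    apply: contraNneq E0 => e0; rewrite -[E]mulmx1 -(mulmxV uQ) mulmxA e0 mul0mx //.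
  have ge0 (j : 'I_N) : 0 <= \sum_i `|(E *m Q) i j| ^+ 2.
    by apply: sumr_ge0 => i _; rewrite exprn_ge0.
  rewrite lt_def gE sumr_ge0 // andbT; apply: contraNneq EQ0 => /eqP.
  rewrite psumr_eq0 // => /allP h; apply/eqP/matrixP => i j.
  have := h j (mem_index_enum _); rewrite psumr_eq0; last first.
    by move=> ? _; rewrite exprn_ge0.
  move=> /allP/(_ i (mem_index_enum _)).
  by rewrite implyTb expf_eq0 normr_eq0 => /eqP ->; rewrite mxE.
have : 0 <= g - `|d| ^+ 2 * g.
  rewrite -g2 -[X in X - _]g1 -linearB /= -mulmxBl -mulmxBr kadison_schwarz.
  apply: hpsd_tr_ge0; rewrite -[X in _ *m X]hadjK; apply: hpsd_congr.
  by apply: hpsd_sum => u _; exact: hpsd_gram.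
rewrite -{1}[g]mul1r -mulrBl pmulr_lge0 // subr_ge0 => h.
by rewrite -(@expr_le1 _ 2).
Qed.

(* For Hermitian [Y], some positive multiple of [Q *m Q] plus [Y] is positive
   semidefinite, hence proportional to a fixed state. *)
Lemma fixed_point_scalar (Q Y : 'M[C]_N) : hadj Q = Q -> Q \in unitmx ->
  T (Q *m Q) = Q *m Q -> \tr (Q *m Q) = 1 ->
  (forall sg, hpsd sg -> \tr sg = 1 -> T sg = sg -> sg = Q *m Q) ->
  T Y = Y -> exists c, Y = c *: (Q *m Q).
Proof.
move=> hQ uQ fixQ trQ uniq.
have herm_case Z : hadj Z = Z -> T Z = Z -> exists c, Z = c *: (Q *m Q).
  move=> hZ fZ; pose W := invmx Q *m Z *m invmx Q.
  have hW : hadj W = W by rewrite !hadjM hadj_inv hQ hZ mulmxA.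
  have [V [d [_ VV dr eW]]] := herm_spectral hW.
  (* The sum of the [|d 0 i|] outweighs every negative eigenvalue of [W], and [1 + |\tr Z|] keeps
     the trace of [P] positive, so that [P] can be normalized. *)
  pose S := 1 + \sum_i `|d 0 i| + `|\tr Z|.
  have S0 : 0 < S.
    by rewrite /S -addrA ltr_pwDl ?addr_ge0 ?sumr_ge0.
  have eZ : Z = Q *m W *m Q.
    by rewrite /W !mulmxA mulmxV // mul1mx -mulmxA mulVmx // mulmx1.
  pose P := S *: (Q *m Q) + Z.
  have trP : \tr P = S + \tr Z by rewrite mxtraceD mxtraceZ trQ mulr1.
  have trZ : \tr Z \is Num.real by apply/CrealP; rewrite -hadj_tr hZ.
  have P0 : 0 < \tr P.
    rewrite trP /S -addrA ltr_pwDl //; last first.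
      by rewrite -[X in _ + X]opprK subr_ge0 (le_trans (real_ler_norm _)) ?realN ?normrN.
    by rewrite ltr_pwDl ?sumr_ge0.
  have psP : hpsd P.
    have -> : P = Q *m V *m diag_mx (\row_i (S + d 0 i)) *m hadj (Q *m V).
      have -> : diag_mx (\row_i (S + d 0 i)) = S%:M + diag_mx d.
        rewrite -diag_const_mx -raddfD; congr diag_mx.
        by apply/rowP => i; rewrite !mxE.
      rewrite mulmxDr mulmxDl /P {1}eZ eW hadjM hQ !mulmxA; congr (_ + _).
      by rewrite mul_mx_scalar -!scalemxAl -[Q *m V *m _]mulmxA VV mulmx1.
    apply/hpsd_congr/hpsd_diag => i; rewrite mxE /S.
    rewrite (bigD1 i) //=.
    have ge0 : 0 <= \sum_(j < N | j != i) `|d 0 j| by exact: sumr_ge0.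
    have di : 0 <= `|d 0 i| + d 0 i.
      by rewrite -[X in _ + X]opprK subr_ge0 (le_trans (real_ler_norm _)) ?realN ?normrN.
    have -> : 1 + (`|d 0 i| + \sum_(j < N | j != i) `|d 0 j|) + `|\tr Z| + d 0 i =
      `|d 0 i| + d 0 i + (\sum_(j < N | j != i) `|d 0 j| + `|\tr Z| + 1) by ring.
    by rewrite addr_ge0 // !addr_ge0.
  have := uniq ((\tr P)^-1 *: P).
  rewrite mxtraceZ mulVf ?gt_eqF // wkrausZ /P wkrausD wkrausZ fixQ fZ.
  have ps : hpsd ((\tr P)^-1 *: P) by apply: hpsdZ => //; rewrite invr_ge0 ltW.
  move=> /(_ ps erefl erefl) /(congr1 ( *:%R (\tr P))).
  rewrite scalerA mulfV ?gt_eqF // scale1r => e.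
  exists (\tr P - S); rewrite scalerBl -e addrAC subrr add0r //.
(* A general [Y] is recovered from the Hermitian fixed points [Y + hadj Y] and
   ['i *: (Y - hadj Y)]. *)
move=> fY.
have fYa : T (hadj Y) = hadj Y.
  by rewrite wkraus_hadj ?fY // => u; exact: real1.
have [c1 e1] : exists c, Y + hadj Y = c *: (Q *m Q).
  by apply: herm_case; rewrite ?hadjD ?hadjK 1?addrC // wkrausD fY fYa addrC.
have [c2 e2] : exists c, 'i *: (Y - hadj Y) = c *: (Q *m Q).
  apply: herm_case.
    by rewrite hadjZ conjCi hadjB hadjK scaleNr -scalerN opprB.
  by rewrite wkrausZ -scaleN1r wkrausD wkrausZ fY fYa.
exists (2^-1 * (c1 - 'i * c2)).
rewrite -scalerA scalerBl -e1 -scalerA -e2 scalerA -expr2 sqrCi scaleN1r opprK.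
by rewrite addrACA subrr addr0 -mulr2n -scaler_nat scalerA mulVf ?scale1r ?pnatr_eq0.
Qed.

End Kraus.

(** * Sums over words of outcomes *)

Section Words.
Variable m : nat.

(** Recursion on the first letter follows the algorithm round by round and drives the inductions on
    the moments. *)
Fixpoint wsum (V : nmodType) K (F : seq 'I_m -> V) : V :=
  if K is K'.+1 then \sum_x wsum K' (fun w => F (x :: w)) else F [::].

Lemma eq_wsum (V : nmodType) K (F G : seq 'I_m -> V) :
  F =1 G -> wsum K F = wsum K G.
Proof.
elim: K F G => [|K IH] F G FG /=; first exact: FG.
by apply: eq_bigr => x _; apply: IH => w; exact: FG.
Qed.

Lemma wsumD (V : nmodType) K (F G : seq 'I_m -> V) :
  wsum K (fun w => F w + G w) = wsum K F + wsum K G.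
Proof.
elim: K F G => [|K IH] F G //=.
by rewrite -big_split; apply: eq_bigr => x _; rewrite IH.
Qed.

Lemma wsumZ (A : pzRingType) K (c : A) (F : seq 'I_m -> A) :
  wsum K (fun w => c * F w) = c * wsum K F.
Proof.
elim: K F => [|K IH] F //=.
by rewrite mulr_sumr; apply: eq_bigr => x _; rewrite IH.
Qed.

Lemma le_wsum (A : numDomainType) K (F G : seq 'I_m -> A) :
  (forall w, F w <= G w) -> wsum K F <= wsum K G.
Proof.
elim: K F G => [|K IH] F G FG /=; first exact: FG.
by apply: ler_sum => x _; apply: IH.
Qed.

Lemma wsum_ge0 (A : numDomainType) K (F : seq 'I_m -> A) :
  (forall w, 0 <= F w) -> 0 <= wsum K F.
Proof.
elim: K F => [|K IH] F F0 /=; first exact: F0.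
by apply: sumr_ge0 => x _; apply: IH.
Qed.

(** The bijections [h] and [g] split a function on ['I_K.+1] into its value at [ord0] and the rest,
    as [enum_ordSl] splits the enumeration. *)
Lemma sum_ffun_wsum (V : nmodType) K (F : seq 'I_m -> V) :
  \sum_(f : {ffun 'I_K -> 'I_m}) F [seq f t | t <- enum 'I_K] = wsum K F.
Proof.
elim: K F => [|K IH] F /=.
  rewrite (bigD1 [ffun i : 'I_0 => False_rect 'I_m (notF (ltn_ord i))]) //=.
  rewrite big1 ?addr0; last first.
    by move=> f /eqP[]; apply/ffunP => -[].
  by rewrite (size0nil (s := enum 'I_0)) // size_enum_ord.
pose h (p : 'I_m * {ffun 'I_K -> 'I_m}) : {ffun 'I_K.+1 -> 'I_m} :=
  [ffun i => if unlift ord0 i is Some j then p.2 j else p.1].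
pose g (f : {ffun 'I_K.+1 -> 'I_m}) : 'I_m * {ffun 'I_K -> 'I_m} :=
  (f ord0, [ffun j => f (lift ord0 j)]).
have hK : cancel h g.
  move=> [x f]; rewrite /g /h !ffunE unlift_none /=; congr pair.
  by apply/ffunP => j; rewrite !ffunE liftK.
have gK : cancel g h.
  move=> f; apply/ffunP => i; rewrite !ffunE.
  by case: unliftP => [j ->|->] //=; rewrite ffunE.
rewrite (reindex h) /=; last by exists g => ? _; [exact: hK|exact: gK].
transitivity (\sum_x \sum_(f : {ffun 'I_K -> 'I_m})
    F (x :: [seq f t | t <- enum 'I_K])); last first.
  by apply: eq_bigr => x _; rewrite -(IH (fun w => F (x :: w))).
rewrite pair_bigA; apply: eq_bigr => -[x f] _; congr F.
rewrite enum_ordSl /= ffunE unlift_none /=; congr cons.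
by rewrite -map_comp; apply: eq_map => j /=; rewrite ffunE liftK.
Qed.

End Words.

(** * Recursions for the moments of the outcome sum *)

Section Moments.
Variables (C : numClosedFieldType) (N m : nat).

Definition scalar_map (f : 'M[C]_N -> C) :=
  forall c X Y, f (c *: X + Y) = c * f X + f Y.

Lemma scalar_map_sum f (I : finType) (c : I -> C) (X : I -> 'M[C]_N) :
  scalar_map f -> f (\sum_i c i *: X i) = \sum_i c i * f (X i).
Proof.
move=> fl; have f0 : f 0 = 0.
  by have := fl (- 1) 0 0; rewrite scaler0 addr0 mulN1r addNr.
by elim/big_rec2: _ => // i y z _ <-; rewrite fl.
Qed.

Lemma scalar_map_sum1 f (I : finType) (X : I -> 'M[C]_N) :
  scalar_map f -> f (\sum_i X i) = \sum_i f (X i).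
Proof.
move=> fl; have := scalar_map_sum (fun=> 1) X fl.
under eq_bigr => i _ do rewrite scale1r.
by under [in RHS]eq_bigr => i _ do rewrite mul1r.
Qed.

Variables (step : 'I_m -> 'M[C]_N -> 'M[C]_N) (a : 'I_m -> C).
Hypothesis step_lin :
  forall x c X Y, step x (c *: X + Y) = c *: step x X + step x Y.

Definition wrun (w : seq 'I_m) (X : 'M[C]_N) := foldl (fun Y x => step x Y) X w.

Definition wscore (w : seq 'I_m) : C := \sum_(x <- w) a x.

(** The [p]-th moment of the sum of the scores. The initial matrix is arbitrary because the
    recursions restart from weighted matrices that are not states. *)
Definition wmoment p K (X : 'M[C]_N) : C :=
  wsum K (fun w => wscore w ^+ p * \tr (wrun w X)).

Definition round X := \sum_x step x X.

Lemma wrun_lin w c X Y : wrun w (c *: X + Y) = c *: wrun w X + wrun w Y.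
Proof. by elim: w X Y => //= x w IH X Y; rewrite step_lin IH. Qed.

Lemma weighted_trace_scalar (g : seq 'I_m -> C) K :
  scalar_map (fun X => wsum K (fun w => g w * \tr (wrun w X))).
Proof.
move=> c X Y; rewrite -wsumZ -wsumD; apply: eq_wsum => w.
by rewrite wrun_lin mxtraceD mxtraceZ mulrDr mulrCA.
Qed.

Lemma wmoment_scalar p K : scalar_map (wmoment p K).
Proof. exact: weighted_trace_scalar. Qed.

Hypothesis round_tr : forall X, \tr (round X) = \tr X.

(** Conservation of total probability: a round summed over its outcome preserves the trace. *)
Lemma wmoment0 K X : wmoment 0 K X = \tr X.
Proof.
elim: K X => [|K IH] X; first by rewrite /wmoment /= mul1r.
rewrite -[RHS]round_tr -IH /round scalar_map_sum1; last exact: wmoment_scalar.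
by apply: eq_bigr => x _; apply: eq_wsum => w; rewrite !expr0.
Qed.

Lemma wmoment1S K X :
  wmoment 1 K.+1 X = \sum_x a x * \tr (step x X) + wmoment 1 K (round X).
Proof.
rewrite /round scalar_map_sum1; last exact: wmoment_scalar.
rewrite -big_split; apply: eq_bigr => x _ /=.
(* The trace after the first letter is spread over the remaining words, so that both sides can be
   compared word by word. *)
rewrite -(wmoment0 K) -wsumZ -wsumD; apply: eq_wsum => w.
by rewrite /wscore big_cons /= !expr1 expr0 mul1r mulrDl.
Qed.

(** Squaring the first score plus the rest; the cross term, which correlates the first outcome with
    the later ones, is a first moment started from a weighted matrix. *)
Lemma wmoment2S K X :
  wmoment 2 K.+1 X = \sum_x a x ^+ 2 * \tr (step x X) +
    2 * wmoment 1 K (\sum_x a x *: step x X) + wmoment 2 K (round X).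
Proof.
rewrite scalar_map_sum; last exact: wmoment_scalar.
rewrite /round scalar_map_sum1; last exact: wmoment_scalar.
rewrite mulr_sumr -!big_split; apply: eq_bigr => x _ /=.
rewrite -(wmoment0 K) -!wsumZ -!wsumD; apply: eq_wsum => w.
rewrite /wscore big_cons /= !expr1 expr0 mul1r.
by ring.
Qed.

End Moments.

(** * Positive functionals dominated by the trace *)

Section PositiveFunctionals.
Variables (C : numClosedFieldType) (N : nat).

(** The matrix is a combination of the rank-one projections onto the columns of [V], and [Phi] maps
    each of them into the unit interval. *)
Lemma positive_functional_bound (Phi : 'M[C]_N -> C) (V : 'M[C]_N) (d : 'rV[C]_N) :
  scalar_map Phi -> (forall X, hpsd X -> 0 <= Phi X <= \tr X) ->
  hadj V *m V = 1%:M ->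
  `|Phi (V *m diag_mx d *m hadj V)| <= \sum_i `|d 0 i|.
Proof.
move=> Phil Phi01 VV; rewrite diag_mx_sum_delta mulmx_sumr mulmx_suml.
under eq_bigr => i _ do rewrite -scalemxAr -scalemxAl.
rewrite scalar_map_sum // (le_trans (ler_norm_sum _ _ _)) //.
apply: ler_sum => i _; rewrite normrM ler_piMr //.
have pE : hpsd (V *m delta_mx i i *m hadj V).
  apply: hpsd_congr; rewrite -(mul_delta_mx (0 : 'I_1)) -(hadj_delta _ 0 i).
  exact: hpsd_gram.
have /andP[P0 P1] := Phi01 _ pE.
rewrite ger0_norm // (le_trans P1) // -mulmxA mxtrace_mulC -mulmxA VV mulmx1.
rewrite -(mul_delta_mx (0 : 'I_1)) mxtrace_mulC mul_delta_mx.
by rewrite /mxtrace big_ord1 mxE.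
Qed.

End PositiveFunctionals.

(** * The measured trajectory and Chebyshev's inequality *)

Section Trajectory.
Variables (C : numClosedFieldType) (N : nat).
Variables (kN : nat) (NK : 'I_kN -> 'M[C]_N) (m : nat) (O : 'I_m -> 'M[C]_N).
Variable a : 'I_m -> C.
Hypothesis a_real : forall x, a x \is Num.real.
Hypothesis NK_chan : \sum_u hadj (NK u) *m NK u = 1%:M.
Hypothesis O_chan : \sum_x hadj (O x) *m O x = 1%:M.

Local Notation TN := (wkraus NK (fun=> 1)).
Local Notation TNd := (wkraus_dual NK (fun=> 1)).
Local Notation TM := (wkraus O (fun=> 1)).
Local Notation TMd := (wkraus_dual O (fun=> 1)).
Local Notation hat := (wkraus O a).
Local Notation hatd := (wkraus_dual O a).

Definition tstep x X := TM (TN (O x *m X *m hadj (O x))).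

Local Notation rnd := (round tstep).
Local Notation moment := (wmoment tstep a).

Lemma wkraus_sum k (K : 'I_k -> 'M[C]_N) b (I : finType) (F : I -> 'M[C]_N) :
  wkraus K b (\sum_i F i) = \sum_i wkraus K b (F i).
Proof.
elim/big_rec2: _ => [|i y z _ <-]; last by rewrite wkrausD.
by have := wkrausZ K b 0 0; rewrite !scale0r.
Qed.

Lemma tstep_lin x c X Y : tstep x (c *: X + Y) = c *: tstep x X + tstep x Y.
Proof.
by rewrite /tstep mulmxDr mulmxDl -scalemxAr -scalemxAl !wkrausD !wkrausZ.
Qed.

Lemma tstep_hpsd x X : hpsd X -> hpsd (tstep x X).
Proof.
by move=> pX; do 2 (apply: wkraus_hpsd => [?|]; first exact: ler01); apply: hpsd_congr.
Qed.

Lemma wrun_hpsd w X : hpsd X -> hpsd (wrun tstep w X).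
Proof. by elim: w X => //= x w IH X pX; apply/IH/tstep_hpsd. Qed.

Lemma tstep_weighted b X : \sum_x b x *: tstep x X = TM (TN (wkraus O b X)).
Proof.
have -> : wkraus O b X = \sum_x b x *: (O x *m X *m hadj (O x)) by [].
rewrite [TN _]wkraus_sum wkraus_sum; apply: eq_bigr => x _.
by rewrite !wkrausZ.
Qed.

Lemma roundE X : rnd X = TM (TN (TM X)).
Proof. by rewrite -tstep_weighted; apply: eq_bigr => x _; rewrite scale1r. Qed.

Lemma round_tr X : \tr (rnd X) = \tr X.
Proof. by rewrite roundE !kraus_tr. Qed.

Lemma tstep_weighted_tr b X : \sum_x b x * \tr (tstep x X) = \tr (wkraus O b X).
Proof.
rewrite -[RHS](kraus_tr NK_chan) -(kraus_tr O_chan) -tstep_weighted mxtrace_sum.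
by apply: eq_bigr => x _; rewrite mxtraceZ.
Qed.

Definition event_prob (bad : pred (seq 'I_m)) K X : C :=
  wsum K (fun w => (bad w)%:R * \tr (wrun tstep w X)).

Lemma event_prob_scalar bad K : scalar_map (event_prob bad K).
Proof. exact: weighted_trace_scalar tstep_lin _ K. Qed.

Lemma event_prob_itv bad K X : hpsd X -> 0 <= event_prob bad K X <= \tr X.
Proof.
move=> pX; have t0 w := hpsd_tr_ge0 (wrun_hpsd w pX).
apply/andP; split; first by apply: wsum_ge0 => w; rewrite mulr_ge0 ?ler0n.
rewrite -(wmoment0 a tstep_lin round_tr K); apply: le_wsum => w.
by rewrite expr0 ler_wpM2r //; case: (bad w); rewrite ?ler01.
Qed.

(** The inequality holds word by word: each word has nonnegative weight, and [t ^+ 2] times the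
    indicator of [bad] is at most the squared score, which is nonnegative as the scores are real. *)
Lemma event_prob_chebyshev (bad : pred (seq 'I_m)) K X t : hpsd X -> 0 <= t ->
  (forall w, bad w -> t ^+ 2 <= wscore a w ^+ 2) ->
  t ^+ 2 * event_prob bad K X <= moment 2 K X.
Proof.
move=> pX t0 h; rewrite -wsumZ; apply: le_wsum => w; rewrite mulrA.
apply: ler_wpM2r; first exact/hpsd_tr_ge0/wrun_hpsd.
case: (boolP (bad w)) => [/h|_]; rewrite ?mulr1 // mulr0 real_exprn_even_ge0 //.
by apply: sum_real => x _.
Qed.

(** * Moment bounds for the stationary process *)

Section Stationary.
Variables (Lh Rh : 'M[C]_N).
Hypotheses (hL : hadj Lh = Lh) (hR : hadj Rh = Rh).
Hypotheses (uL : Lh \in unitmx) (uR : Rh \in unitmx).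

Local Notation wip := (wip Lh Rh).
Local Notation gam := (gam Lh Rh).
Local Notation A := (hatd 1%:M).

Hypothesis saN : forall X Y, wip X (TNd Y) = wip (TNd X) Y.
Hypothesis saM : forall X Y, wip X (TMd Y) = wip (TMd X) Y.
Hypothesis saH : forall X Y, wip X (hatd Y) = wip (hatd X) Y.


Lemma wip1 Y : wip 1%:M Y = \tr (gam Y).
Proof. by rewrite /wip hadj1 mul1mx. Qed.

Lemma hat_tr_gam Y : \tr (hat (gam Y)) = wip A Y.
Proof.
by rewrite (gam_intertwine (wkraus_dualP O a) saH) -wip1 saH.
Qed.

(** For centered outcomes and [gam 1%:M] the Gibbs state, the left side is the covariance, so this
    identifies [wip A A] with it. *)
Lemma hat_hat_tr : \tr (hat (hat (gam 1%:M))) = wip A A.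
Proof. by rewrite (gam_intertwine (wkraus_dualP O a) saH) hat_tr_gam. Qed.

Lemma round_gam Y : rnd (gam Y) = gam (TMd (TNd (TMd Y))).
Proof.
rewrite roundE (gam_intertwine (wkraus_dualP O _) saM).
rewrite (gam_intertwine (wkraus_dualP NK _) saN).
by rewrite (gam_intertwine (wkraus_dualP O _) saM).
Qed.

Lemma perpM Y : wip 1%:M Y = 0 -> wip 1%:M (TMd Y) = 0.
Proof. by rewrite saM kraus_dual1. Qed.

Lemma perpN Y : wip 1%:M Y = 0 -> wip 1%:M (TNd Y) = 0.
Proof. by rewrite saN kraus_dual1. Qed.

Variable lam : C.
Hypothesis lam_ge0 : 0 <= lam.
Hypothesis lam_lt1 : lam < 1.
Hypothesis contractM : forall X, wip (TMd X) (TMd X) <= wip X X.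
Hypothesis contractN : forall X, wip 1%:M X = 0 ->
  wip (TNd X) (TNd X) <= lam ^+ 2 * wip X X.

(** A geometric series summed by induction on [K]. The next outcome contributes [wip A Y], at most
    [r * wip A A] by Cauchy-Schwarz; one round then replaces [r] by [lam * r], and
    [r + lam * r / (1 - lam) = r / (1 - lam)] closes the induction. *)
Lemma moment1_bound K Y r : 0 <= r -> wip 1%:M Y = 0 ->
  wip Y Y <= r ^+ 2 * wip A A ->
  'Re (moment 1 K (gam Y)) <= r * wip A A / (1 - lam).
Proof.
have A0 : 0 <= wip A A by exact: wip_ge0.
have l1 : 0 < 1 - lam by rewrite subr_gt0.
elim: K Y r => [|K IH] Y r r0 pY qY.
  rewrite /wmoment /= /wscore big_nil expr1 mul0r raddf0.
  by rewrite divr_ge0 ?mulr_ge0 // ltW.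
rewrite (wmoment1S a tstep_lin round_tr) tstep_weighted_tr hat_tr_gam round_gam.
rewrite raddfD /=.
have q' : wip (TMd (TNd (TMd Y))) (TMd (TNd (TMd Y))) <= (lam * r) ^+ 2 * wip A A.
  apply: le_trans (contractM _) _; apply: le_trans (contractN (perpM pY)) _.
  rewrite exprMn -[leRHS]mulrA; apply: ler_wpM2l; first by rewrite exprn_ge0.
  exact: le_trans (contractM _) qY.
have := IH _ _ (mulr_ge0 lam_ge0 r0) (perpM (perpN (perpM pY))) q'.
have := wip_cauchy hL hR uL uR r0 qY.
move=> /lerD h /h{h} h; apply: le_trans h _.
rewrite ler_pdivlMr // mulrDl divfK ?gt_eqF //.
by have -> : r * wip A A * (1 - lam) + lam * r * wip A A = r * wip A A by ring.
Qed.

Hypothesis centered : \tr (hat (gam 1%:M)) = 0.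

Lemma perpA : wip 1%:M A = 0.
Proof. by rewrite wip1 -(gam_intertwine (wkraus_dualP O a) saH). Qed.

(** A round fixes [gam 1%:M], so every step of the recursion adds the same variance and a cross term
    started from [gam (TMd (TNd A))], which [moment1_bound] controls uniformly in the remaining
    length. *)
Lemma moment2_bound K :
  'Re (moment 2 K (gam 1%:M)) <=
    K%:R * ('Re (\tr (wkraus O (fun x => a x ^+ 2) (gam 1%:M))) +
            2 * (wip A A / (1 - lam))).
Proof.
elim: K => [|K IH].
  by rewrite /wmoment /= /wscore big_nil expr0n mul0r raddf0 mul0r.
rewrite (wmoment2S a tstep_lin round_tr) (tstep_weighted_tr (fun x => a x ^+ 2)).
rewrite tstep_weighted round_gam !kraus_dual1 //.
rewrite (gam_intertwine (wkraus_dualP O a) saH).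
rewrite (gam_intertwine (wkraus_dualP NK _) saN).
rewrite (gam_intertwine (wkraus_dualP O _) saM).
rewrite -[K.+1%:R]natr1 [leRHS]mulrDl mul1r !raddfD /= [leRHS]addrC.
apply: lerD => //; apply: lerD => //.
rewrite mulr_natl raddfMn /= mulr_natl lerMn2r //=.
rewrite -[leRHS]mul1r mulrA; apply: moment1_bound => //.
  exact/perpM/perpN/perpA.
(* Here [r = 1]: the factor [lam ^+ 2] gained from the channel is simply bounded by 1. *)
apply: le_trans (contractM _) _; apply: le_trans (contractN perpA) _.
by rewrite ler_wpM2r ?wip_ge0 // expr1n exprn_ile1 // ltW.
Qed.

End Stationary.
End Trajectory.

(** * Spectrum of a channel in detailed balance *)

Section ChannelSpectrum.
Variables (C : numClosedFieldType) (N : nat) (Lh Rh Q : 'M[C]_N).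
Hypotheses (hL : hadj Lh = Lh) (hR : hadj Rh = Rh) (hQ : hadj Q = Q).
Hypotheses (uL : Lh \in unitmx) (uR : Rh \in unitmx) (uQ : Q \in unitmx).
Variables (k : nat) (K : 'I_k -> 'M[C]_N).
Hypothesis K_chan : \sum_u hadj (K u) *m K u = 1%:M.

Local Notation T := (wkraus K (fun=> 1)).
Local Notation Td := (wkraus_dual K (fun=> 1)).
Local Notation wip := (wip Lh Rh).
Local Notation gam := (gam Lh Rh).

Hypothesis gamQ : gam 1%:M = Q *m Q.
Hypothesis saT : forall X Y, wip X (Td Y) = wip (Td X) Y.

Lemma kraus_fix_gibbs : T (Q *m Q) = Q *m Q.
Proof.
by rewrite -gamQ (gam_intertwine (wkraus_dualP K _) saT) kraus_dual1.
Qed.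

Lemma eigenbasis_neq0 E d j : eigenbasis Lh Rh Td E d -> E j != 0.
Proof.
move=> [_ on _ _]; apply/eqP => Ej0; have := on j j.
rewrite Ej0 eqxx -(scale0r (0 : 'M[C]_N)) wipZr // mul0r => /esym/eqP.
by rewrite oner_eq0.
Qed.

(** Detailed balance makes [Q *m Q] invariant, so Kadison-Schwarz bounds every eigenvalue by 1 in
    modulus. This is the form used for the measurement channel. *)
Lemma channel_dual_contract X : wip (Td X) (Td X) <= wip X X.
Proof.
have [E [d eb]] := selfadjoint_eigenbasis hL hR uL uR saT.
rewrite -[leRHS]mul1r -[in leRHS](expr1n _ 2).
apply: (wip_contract hL hR saT eb) => j; left.
have [_ _ TE _] := eb.
exact: (kraus_dual_eigen_le1 K_chan hQ uQ kraus_fix_gibbs (eigenbasis_neq0 j eb) (TE j)).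
Qed.

(** [gam] carries eigenvectors of the dual to eigenvectors of [T] with the same eigenvalue, so the
    assumptions on [T] transfer. For eigenvalue 1, [gam (E j)] is a multiple of [gam 1%:M], whence
    [E j] pairs to zero with everything orthogonal to the identity. *)
Lemma ergodic_eigenbasis : \tr (Q *m Q) = 1 ->
  (forall sg, hpsd sg -> \tr sg = 1 -> T sg = sg -> sg = Q *m Q) ->
  (forall z X, X != 0 -> T X = z *: X -> 0 <= z <= 1) ->
  exists E d, [/\ eigenbasis Lh Rh Td E d,
    forall j, 0 <= d j <= 1,
    forall j, d j != 1 -> wip (E j) 1%:M = 0
    & forall j X, d j = 1 -> wip X 1%:M = 0 -> wip (E j) X = 0].
Proof.
move=> trQ uniq spec.
have [E [d eb]] := selfadjoint_eigenbasis hL hR uL uR saT.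
have [_ on TE _] := eb.
have Tgam j : T (gam (E j)) = d j *: gam (E j).
  rewrite (gam_intertwine (wkraus_dualP K _) saT) TE.
  by rewrite /gam -scalemxAr -scalemxAl.
exists E, d; split=> // [j|j dj|j X dj X1].
- apply: spec (Tgam j); apply/eqP => g0; have := on j j.
  rewrite /wip g0 mulmx0 raddf0 eqxx => /esym/eqP.
  by rewrite oner_eq0.
- have := saT (E j) 1%:M; rewrite kraus_dual1 // TE wipZl //.
  have [dr _ _ _] := eb; rewrite (conj_Creal (dr j)) => /eqP.
  rewrite eq_sym -subr_eq0 -[X in _ - X]mul1r -mulrBl mulf_eq0 subr_eq0.
  by rewrite (negbTE dj) => /eqP.
- have [c ec] := fixed_point_scalar hQ uQ kraus_fix_gibbs trQ uniq
    (etrans (Tgam j) (etrans (congr1 ( *:%R^~ _) dj) (scale1r _))).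
  rewrite -wipC // {1}/wip ec -gamQ -scalemxAr mxtraceZ -/(wip X 1%:M) X1.
  by rewrite mulr0 conjC0.
Qed.

Lemma rayleigh_eigenbasis E d X : eigenbasis Lh Rh Td E d ->
  wip X (Td X) = \sum_j d j * `|wip (E j) X| ^+ 2.
Proof.
move=> [dr _ TE pars]; rewrite pars; apply: eq_bigr => j _.
by rewrite saT TE wipZl // (conj_Creal (dr j)) mulrCA normCKC.
Qed.

Lemma wip_eigenbasis E d X : eigenbasis Lh Rh Td E d ->
  wip X X = \sum_j `|wip (E j) X| ^+ 2.
Proof.
by move=> [dr _ TE pars]; rewrite pars; apply: eq_bigr => j _; rewrite normCKC.
Qed.

(** The quotient is an average of eigenvalues, weighted by the squared coordinates of [X]. *)
Lemma rayleigh_quotient_bound E d l X : eigenbasis Lh Rh Td E d ->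
  (forall j, 0 <= d j) -> (forall j, d j <= l \/ wip (E j) X = 0) -> X != 0 ->
  0 <= wip X (Td X) / wip X X <= l.
Proof.
move=> eb d0 dl X0.
have w0 : 0 < wip X X.
  rewrite lt_def wip_ge0 // andbT; apply: contraNneq X0.
  by move=> /(wip_eq0 hL hR uL uR) ->.
rewrite divr_ge0 ?(ltW w0) //=; last first.
  rewrite (rayleigh_eigenbasis _ eb); apply: sumr_ge0 => j _.
  by rewrite mulr_ge0 ?exprn_ge0.
rewrite ler_pdivrMr // (rayleigh_eigenbasis _ eb) (wip_eigenbasis _ eb) mulr_sumr.
apply: ler_sum => j _; have [dj|->] := dl j; last by rewrite normr0 expr0n !mulr0.
by rewrite ler_wpM2r ?exprn_ge0.
Qed.

Lemma rayleigh_quotient_eigen E d j : eigenbasis Lh Rh Td E d ->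
  wip (E j) (Td (E j)) / wip (E j) (E j) = d j.
Proof. by move=> [_ on TE _]; rewrite TE wipZr // on eqxx mulr1 divr1. Qed.

End ChannelSpectrum.

(** * Traces against unitary matrices *)

Lemma unitary_entry_le1 (C : numClosedFieldType) N (V : 'M[C]_N) i j :
  hadj V *m V = 1%:M -> `|V i j| <= 1.
Proof.
move=> /matrixP/(_ j j); rewrite !mxE eqxx (bigD1 i) //= hadjE => e.
rewrite -(@expr_le1 _ 2) // -[leRHS]e normCKC lerDl; apply: sumr_ge0 => l _.
by rewrite hadjE mulrC mul_conjC_ge0.
Qed.

(** A crude bound, but independent of [V] and [W]: it shows that the set whose supremum is [trnorm]
    is bounded. *)
Lemma tr_unitary_le (C : numClosedFieldType) N (V W A : 'M[C]_N) :
  hadj V *m V = 1%:M -> hadj W *m W = 1%:M ->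
  `|\tr (V *m A *m W)| <= \sum_(i < N) \sum_(k < N) \sum_(j < N) `|A j k|.
Proof.
move=> uV uW; apply: le_trans (ler_norm_sum _ _ _) _.
apply: ler_sum => i _; rewrite mxE; apply: le_trans (ler_norm_sum _ _ _) _.
apply: ler_sum => k _; rewrite mxE normrM.
apply: le_trans (_ : `|\sum_j V i j * A j k| * 1 <= _).
  by rewrite ler_wpM2l // unitary_entry_le1.
rewrite mulr1; apply: le_trans (ler_norm_sum _ _ _) _.
apply: ler_sum => j _; rewrite normrM -[leRHS]mul1r ler_wpM2r //.
exact: unitary_entry_le1.
Qed.

(** * Functional calculus and powers of the Gibbs state *)

Section Gibbs.
Variables (R : realType) (N : nat) (beta : R) (U : 'M[R[i]]_N) (lam : 'I_N -> R).
Hypothesis uU : unitary_mx U.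
Hypothesis N_gt0 : (0 < N)%N.

Local Notation gp := (gibbs_pow beta U lam).

Lemma hadj_diagR (d : 'I_N -> R) : hadj (diagR d) = diagR d.
Proof.
apply/matrixP=> i j; rewrite hadjE !mxE eq_sym.
case: eqP => [->|_]; rewrite ?mulr1n ?mulr0n ?conjC0 //.
by rewrite conj_Creal // complex_real.
Qed.

Lemma diagR_mul (d e : 'I_N -> R) :
  diagR d *m diagR e = diagR (fun i => d i * e i).
Proof.
rewrite /diagR mulmx_diag; congr diag_mx; apply/rowP => i.
by rewrite !mxE rmorphM.
Qed.

Lemma tr_diagR (d : 'I_N -> R) : \tr (diagR d) = ((\sum_i d i)%:C)%C.
Proof.
by rewrite mxtrace_diag rmorph_sum; apply: eq_bigr => i _; rewrite mxE.
Qed.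

Lemma fcalc_hadj f : hadj (fcalc U lam f) = fcalc U lam f.
Proof.
rewrite /fcalc -[adj U]/(hadj U) !hadjM hadjK hadj_diagR.
by rewrite mulmxA.
Qed.

Lemma fcalc_mul f g :
  fcalc U lam f *m fcalc U lam g = fcalc U lam (fun x => f x * g x).
Proof.
rewrite /fcalc !mulmxA -[_ *m adj U *m U]mulmxA uU mulmx1.
by rewrite -[U *m _ *m _]mulmxA diagR_mul.
Qed.

Lemma fcalc_tr f : \tr (fcalc U lam f) = ((\sum_i f (lam i))%:C)%C.
Proof. by rewrite /fcalc mxtrace_mulC mulmxA uU mul1mx tr_diagR. Qed.

Lemma partfun_gt0 : 0 < partfun beta lam.
Proof.
rewrite /partfun (bigD1 (Ordinal N_gt0)) //= ltr_pwDl ?expR_gt0 //.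
by apply: sumr_ge0 => i _; exact: expR_ge0.
Qed.

Lemma gibbs_powD p q : gp p *m gp q = gp (p + q).
Proof.
rewrite /gibbs_pow fcalc_mul /fcalc; congr (_ *m _ *m _); congr diag_mx.
apply/rowP => i; rewrite !mxE -powRD //.
apply/implyP => _; apply: lt0r_neq0.
by rewrite divr_gt0 ?expR_gt0 ?partfun_gt0.
Qed.

Lemma gibbs_pow0 : gp 0 = 1%:M.
Proof.
rewrite /gibbs_pow /fcalc (_ : diagR _ = 1%:M); last first.
  by apply/matrixP => i j; rewrite !mxE powRr0.
by rewrite mulmx1; apply: mulmx1C; exact: uU.
Qed.

Lemma gibbs_pow_unit p : gp p \in unitmx.
Proof.
have e : gp p *m gp (- p) = 1%:M by rewrite gibbs_powD (subrr p); exact: gibbs_pow0.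
exact: (proj1 (mulmx1_unit e)).
Qed.

Lemma gibbs_pow_herm p : hadj (gp p) = gp p.
Proof. exact: fcalc_hadj. Qed.

Lemma gibbs_pow1 : gp 1 = gibbs beta U lam.
Proof.
rewrite /gibbs_pow /gibbs fcalc_tr /fcalc scalemxAl scalemxAr.
apply: (congr1 (fun D => U *m D *m adj U)); apply/matrixP => i j; rewrite !mxE.
rewrite powRr1; last by rewrite divr_ge0 ?expR_ge0 // ltW ?partfun_gt0.
by case: eqP => _; rewrite ?mulr0n ?mulr0 // !mulr1n rmorphM fmorphV mulrC.
Qed.

Lemma ip_s_wip s A B :
  ip_s beta U lam s A B = wip (gp ((1 - s) / 2)) (gp (s / 2)) A B.
Proof.
rewrite /ip_s /wip /gam !gibbs_powD -(splitr (1 - s)) -(splitr s).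
by rewrite !mulmxA.
Qed.

(** The exponents add up to 1 for every [s], so the identity is sent to the Gibbs state, written as
    a square because the spectral lemmas take the invariant state in the form [Q *m Q]. *)
Lemma gam_gibbs s :
  gam (gp ((1 - s) / 2)) (gp (s / 2)) 1%:M = gp 2^-1 *m gp 2^-1.
Proof.
have e : (1 - s) / 2 + (1 - s) / 2 + (s / 2 + s / 2) = 2^-1 + 2^-1 by lra.
rewrite /gam mulmx1 (gibbs_powD ((1 - s) / 2)) (gibbs_powD (s / 2)).
by rewrite (gibbs_powD _ (s / 2 + s / 2)) (gibbs_powD 2^-1) e.
Qed.

Lemma gibbs_sqr : gp 2^-1 *m gp 2^-1 = gibbs beta U lam.
Proof.
have e : 2^-1 + 2^-1 = 1 :> R by lra.
by rewrite gibbs_powD e gibbs_pow1.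
Qed.

End Gibbs.

(** * Lower bound for the trace norm *)

Section TraceNorm.
Variables (R : realType) (N : nat).

(** The spectral decomposition becomes a singular value decomposition by moving the signs of [d]
    into the right unitary factor. Boundedness must be checked as well, since the supremum of an
    unbounded set is 0 by default. *)
Lemma trnorm_spectral_ge (V : 'M[R[i]]_N) (d : 'I_N -> R) : unitary_mx V ->
  \sum_i `|d i| <= trnorm (V *m diagR d *m adj V).
Proof.
move=> uV; apply: ub_le_sup; last first.
  exists V, (diagR (fun i => if d i < 0 then -1 else 1) *m adj V), (fun i => `|d i|).
  split=> //.
    rewrite /unitary_mx -[adj _]/(hadj _) hadjM hadj_diagR -[adj V]/(hadj V) hadjK.
    rewrite mulmxA -[V *m _ *m _]mulmxA diagR_mul.
    rewrite (_ : diagR _ = 1%:M).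
      by rewrite mulmx1; apply: mulmx1C; exact: uV.
    apply/matrixP => i j; rewrite !mxE; case: ifP => _; rewrite ?mulrNN ?mulr1 //.
  rewrite !mulmxA -[V *m _ *m diagR _]mulmxA diagR_mul; congr (_ *m diag_mx _ *m _).
  apply/rowP => i; rewrite !mxE; congr (_%:C)%C.
  case: (ltP (d i) 0) => di; first by rewrite ltr0_norm // mulrNN mulr1.
  by rewrite ger0_norm // mulr1.
set A := V *m _ *m _.
pose M : R[i] := \sum_(i < N) \sum_(k < N) \sum_(j < N) `|A j k|.
exists (complex.Re M) => _ [V' [W [e [uV' uW e0 eA ->]]]].
have : ((\sum_i e i)%:C)%C <= M.
  (* Undoing the two unitary factors expresses any sum of singular values as a trace, to which the
     uniform bound applies. *)
  have -> : ((\sum_i e i)%:C)%C = `|\tr (hadj V' *m A *m hadj W)|.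
    rewrite eA !mulmxA -[hadj V']/(adj V') uV' mul1mx -mulmxA.
    rewrite (mulmx1C uW : W *m hadj W = 1%:M) mulmx1 tr_diagR ger0_norm //.
    by rewrite ler0c sumr_ge0.
  apply: tr_unitary_le; rewrite hadjK; apply: mulmx1C; [exact: uV'|exact: uW].
by rewrite lecE => /andP[_].
Qed.

End TraceNorm.

(** * Real parts of complex numbers *)

Section ComplexParts.
Variable R : realType.
Local Notation Re := complex.Re.

Lemma le_Re (x y : R[i]) : x <= y -> Re x <= Re y.
Proof. by rewrite lecE => /andP[]. Qed.

Lemma ReD (x y : R[i]) : Re (x + y) = Re x + Re y.
Proof. by case: x => ? ?; case: y. Qed.

Lemma Re_realM (c : R) (x : R[i]) : Re ((c%:C)%C * x) = c * Re x.
Proof. by case: x => a b /=; rewrite mul0r subr0. Qed.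

Lemma Re_sum (I : Type) (r : seq I) (P : pred I) (F : I -> R[i]) :
  Re (\sum_(i <- r | P i) F i) = \sum_(i <- r | P i) Re (F i).
Proof. by elim/big_rec2: _ => // i x y _ <-; rewrite ReD. Qed.

Lemma ge0_ReE (x : R[i]) : 0 <= x -> x = ((Re x)%:C)%C.
Proof. by move=> x0; rewrite RRe_real // ger0_real. Qed.

End ComplexParts.

(** * Channels as Kraus maps with weight 1 *)

Section KrausBridge.
Variables (R : realType) (N k : nat) (K : 'I_k -> 'M[R[i]]_N).

Lemma kraus_mapE X : kraus_map K X = wkraus K (fun=> 1) X.
Proof. by apply: eq_bigr => u _; rewrite scale1r. Qed.

Lemma kraus_dualE X : kraus_dual K X = wkraus_dual K (fun=> 1) X.
Proof. by apply: eq_bigr => u _; rewrite conjC1 scale1r. Qed.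

End KrausBridge.

(** * The spectral gap *)

Section Gap.
Variables (R : realType) (N : nat) (beta : R) (U : 'M[R[i]]_N) (lam : 'I_N -> R).
Variables (s : R) (k : nat) (K : 'I_k -> 'M[R[i]]_N).
Hypotheses (uU : unitary_mx U) (N_gt0 : (0 < N)%N).
Local Notation rho := (gibbs beta U lam).
Local Notation Lh := (gibbs_pow beta U lam ((1 - s) / 2)).
Local Notation Rh := (gibbs_pow beta U lam (s / 2)).
Local Notation Qh := (gibbs_pow beta U lam 2^-1).
Local Notation wip := (wip Lh Rh).
Local Notation T := (wkraus K (fun=> 1)).
Local Notation Td := (wkraus_dual K (fun=> 1)).

Hypothesis K_chan : is_channel K.
Hypothesis db : detailed_balance beta U lam s (kraus_dual K).
Hypothesis uniq : unique_fixed_state (kraus_map K) rho.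
Hypothesis spec : spectrum_in_01 (kraus_map K).

Lemma detailed_balance_wip (S : 'M[R[i]]_N -> 'M[R[i]]_N) :
  detailed_balance beta U lam s S -> forall X Y, wip X (S Y) = wip (S X) Y.
Proof. by move=> h X Y; have := h X Y; rewrite !ip_s_wip. Qed.

(** The set [S] of Rayleigh quotients contains every eigenvalue other than 1 and is bounded by the
    largest of them, which is below 1. The first fact gives the contraction, the second the
    positivity of the gap. *)
Lemma gap_spec (g := gap beta U lam s (kraus_dual K)) :
  [/\ 0 < g, g <= 1 & forall X, wip 1%:M X = 0 ->
    wip (Td X) (Td X) <= (((1 - g)%:C)%C) ^+ 2 * wip X X].
Proof.
have hL := gibbs_pow_herm beta U lam ((1 - s) / 2).
have hR := gibbs_pow_herm beta U lam (s / 2).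
have hQ := gibbs_pow_herm beta U lam 2^-1.
have uL := gibbs_pow_unit beta lam uU N_gt0 ((1 - s) / 2).
have uR := gibbs_pow_unit beta lam uU N_gt0 (s / 2).
have uQ := gibbs_pow_unit beta lam uU N_gt0 2^-1.
have gamQ := gam_gibbs beta lam uU N_gt0 s.
have rhoE := gibbs_sqr beta lam uU N_gt0.
have saT X Y : wip X (Td Y) = wip (Td X) Y.
  by rewrite -!kraus_dualE; apply: detailed_balance_wip.
have [[_ trrho] [_ uq]] := uniq.
have [||E [d [eb d01 dne d1]]] :=
  ergodic_eigenbasis hL hR hQ uL uR uQ K_chan gamQ saT
    (etrans (congr1 mxtrace rhoE) trrho).
- move=> sg psg tsg fsg; rewrite rhoE; apply: uq; first by split.
  by rewrite kraus_mapE.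
- by move=> z X X0 TX; apply: spec; exists X; rewrite ?kraus_mapE.
have [dr on TE pars] := eb.
have dE j : d j = ((complex.Re (d j))%:C)%C by rewrite RRe_real.
(* The largest eigenvalue different from 1, or 0 if there is none. *)
pose l0 := \big[Num.max/0]_(j | d j != 1) complex.Re (d j).
have l0_lt1 : l0 < 1.
  apply: bigmax_lt => [|j dj]; first exact: ltr01.
  by rewrite -ltcR -dE lt_neqAle dj; case/andP: (d01 j).
have dl0 j : d j != 1 -> d j <= (l0%:C)%C.
  move=> dj; rewrite dE lecR.
  exact: (le_bigmax_cond _ (fun j => complex.Re (d j)) dj).
rewrite /g /gap; set S := (X in sup X).
have S_bound r : S r -> 0 <= r <= l0.
  move=> [X [X0 [X1 ->]]]; rewrite ip_s_wip in X1; last 2 first.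
  - exact: uU.
  - exact: N_gt0.
  have dl j : d j <= (l0%:C)%C \/ wip (E j) X = 0.
    have [dj|dj] := eqVneq (d j) 1; first by right; exact: d1 dj X1.
    by left; exact: dl0.
  have d0 j : 0 <= d j by case/andP: (d01 j).
  have := rayleigh_quotient_bound hL hR uL uR saT eb d0 dl X0.
  rewrite !(ip_s_wip beta lam uU N_gt0) kraus_dualE => /andP[q0 q1].
  by apply/andP; split; [exact: (le_Re q0)|exact: (le_Re q1)].
have S_eig j : d j != 1 -> S (complex.Re (d j)).
  move=> dj; exists (E j); split; first exact: (eigenbasis_neq0 hL hR j eb).
  rewrite !(ip_s_wip beta lam uU N_gt0) kraus_dualE.
  split; first exact: dne.
  by rewrite (rayleigh_quotient_eigen hL hR j eb).
have hub : has_ubound S by exists l0 => r /S_bound /andP[].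
(* If no nonzero matrix is orthogonal to the identity, [S] is empty, its supremum is 0 and the gap
   is 1; this case is treated separately here and for [l_lt1]. *)
have l_ge0 : 0 <= sup S.
  have [[r Sr]|S0] := pselect (S !=set0)%classic.
    have /andP[r0 _] := S_bound _ Sr; apply: le_trans r0 _.
    exact: ub_le_sup.
  have -> : S = classical_sets.set0 by apply: contra_notP S0 => /eqP/set0P.
  by rewrite sup0; exact: lexx.
have l_lt1 : sup S < 1.
  have [[r Sr]|S0] := pselect (S !=set0)%classic.
    apply: le_lt_trans l0_lt1; apply: ge_sup; first by exists r.
    by move=> x /S_bound /andP[].
  have -> : S = classical_sets.set0 by apply: contra_notP S0 => /eqP/set0P.
  by rewrite sup0; exact: ltr01.
split; [by rewrite subr_gt0|by rewrite gerBl|move=> X X1].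
have Xp : wip X 1%:M = 0.
  by rewrite -(wipC hL hR) X1; exact: conjC0.
apply: (wip_contract hL hR saT eb) => j.
have [dj|dj] := eqVneq (d j) 1; first by right; exact: d1 dj Xp.
(* An eigenvalue other than 1 is itself a member of [S], hence at most [sup S], which is 1 minus the
   gap. *)
left; rewrite ger0_norm; last by case/andP: (d01 j).
by rewrite subKr dE lecR; apply: ub_le_sup; [exact: hub|exact: S_eig].
Qed.

End Gap.

(** * The algorithm and its statistics in terms of weighted Kraus maps *)

Section TrajectoryBridge.
Variables (R : realType) (N kN m : nat).
Variables (NK : 'I_kN -> 'M[R[i]]_N) (val : 'I_m -> R) (O : 'I_m -> 'M[R[i]]_N).
Local Notation Re := complex.Re.

Lemma wkraus_tr (b : 'I_m -> R[i]) X :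
  \tr (wkraus O b X) = \sum_x b x * \tr (O x *m X *m hadj (O x)).
Proof. by rewrite mxtrace_sum; apply: eq_bigr => x _; rewrite mxtraceZ. Qed.

Lemma run_roundsE w X : run_rounds NK O w X = wrun (tstep NK O) w X.
Proof.
elim: w X => [//|x w IH] X; rewrite /= -IH; congr foldl.
by rewrite /round_step /tstep -!kraus_mapE.
Qed.

(** Multiplying the deviation of the average by [K] turns it into the absolute value of the centered
    score, the quantity whose moments are bounded. *)
Lemma alg_dev_probE rho Tburn K mu eps : (0 < K)%N ->
  alg_dev_prob NK val O rho Tburn K mu eps =
  Re (event_prob NK O
        (fun w => K%:R * eps <= `|\sum_(x <- w) (val x - mu)|) K
        (iter Tburn (kraus_map NK) rho)).
Proof.
move=> K0; rewrite /alg_dev_prob /event_prob -sum_ffun_wsum Re_sum big_mkcond.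
apply: eq_bigr => f _; rewrite run_roundsE.
have K0' : 0 < K%:R :> R by rewrite ltr0n.
have -> : (eps <= `|K%:R^-1 * (\sum_(t < K) val (f t)) - mu|) =
    (K%:R * eps <= `|\sum_(x <- [seq f t | t <- enum 'I_K]) (val x - mu)|).
  have -> : \sum_(x <- [seq f t | t <- enum 'I_K]) (val x - mu) =
      \sum_(t < K) (val (f t) - mu).
    by rewrite big_map big_enum; apply: eq_bigl => t; rewrite inE.
  rewrite sumrB sumr_const card_ord -[mu *+ K]mulr_natl.
  have -> : \sum_(t < K) val (f t) - K%:R * mu =
      K%:R * (K%:R^-1 * (\sum_(t < K) val (f t)) - mu).
    by rewrite mulrBr mulVKf // gt_eqF.
  by rewrite normrM gtr0_norm // ler_pM2l.
by case: ifP => _; rewrite ?mul1r ?mul0r.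
Qed.

Lemma meas_varE rho :
  meas_var val O rho =
  Re (\tr (wkraus O (fun x => (((val x - meas_mean val O rho)%:C)%C) ^+ 2) rho)).
Proof.
rewrite wkraus_tr Re_sum; apply: eq_bigr => x _.
by rewrite -rmorphXn Re_realM real_normK // num_real.
Qed.

Lemma meas_covE rho (a := fun x => ((val x - meas_mean val O rho)%:C)%C) :
  meas_cov val O rho = Re (\tr (wkraus O a (wkraus O a rho))).
Proof.
rewrite wkraus_tr Re_sum /meas_cov exchange_big; apply: eq_bigr => y _.
rewrite Re_realM {1}/wkraus mulmx_sumr mulmx_suml mxtrace_sum Re_sum mulr_sumr.
apply: eq_bigr => x _.
by rewrite -scalemxAr -scalemxAl mxtraceZ Re_realM mulrA [X in X * _]mulrC !mulmxA.
Qed.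

Lemma hat_centered rho (a := fun x => ((val x - meas_mean val O rho)%:C)%C) :
  is_channel O -> is_state rho -> \tr (wkraus O a rho) = 0.
Proof.
move=> chan [psd_rho tr_rho]; rewrite wkraus_tr.
have trE x : \tr (O x *m rho *m hadj (O x)) = ((outcome_prob O rho x)%:C)%C.
  by apply: ge0_ReE; apply: hpsd_tr_ge0; apply: hpsd_congr.
have sum1 : \sum_x outcome_prob O rho x = 1.
  have : \tr (wkraus O (fun=> 1) rho) = 1 by rewrite kraus_tr.
  rewrite wkraus_tr => /(congr1 (@complex.Re R)); rewrite Re_sum => e.
  by rewrite -[RHS]e; apply: eq_bigr => x _; rewrite mul1r.
transitivity ((\sum_x (val x - meas_mean val O rho) * outcome_prob O rho x)%:C)%C.
  by rewrite rmorph_sum; apply: eq_bigr => x _; rewrite trE rmorphM.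
under eq_bigr => x _ do rewrite mulrBl.
by rewrite sumrB -mulr_sumr sum1 mulr1 subrr.
Qed.

Lemma norm_realC (x : R) : `|(x%:C)%C| = (`|x|%:C)%C.
Proof.
case: (ltP x 0) => x0.
  by rewrite [in RHS]ltr0_norm // rmorphN ltr0_norm // ltcR.
by rewrite [in RHS]ger0_norm // ger0_norm // lecR.
Qed.

(** By linearity only the Hermitian difference matters; the sum of the absolute values of its
    eigenvalues bounds the functional from above and is at most the trace norm. *)
Lemma event_prob_trnorm (bad : pred (seq 'I_m)) K sg rho :
  is_channel NK -> is_channel O -> is_state sg -> is_state rho ->
  Re (event_prob NK O bad K sg) <=
    Re (event_prob NK O bad K rho) + trnorm (sg - rho).
Proof.
move=> cN cO [psg _] [prho _].
have hD : hadj (sg - rho) = sg - rho.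
  by rewrite hadjB (hpsd_herm (psg : hpsd sg)) (hpsd_herm (prho : hpsd rho)).
have [V [d [VV _ dr eD]]] := herm_spectral hD.
have epl := event_prob_scalar NK O bad K.
have -> : event_prob NK O bad K sg =
    event_prob NK O bad K rho + event_prob NK O bad K (sg - rho).
  by rewrite -[in LHS](subrK rho sg) -[sg - rho]scale1r epl mul1r addrC scale1r.
rewrite ReD lerD2l.
have eD' : sg - rho = V *m diagR (fun i => Re (d 0 i)) *m adj V.
  apply: (etrans eD); apply: (congr1 (fun D => V *m diag_mx D *m hadj V)).
  by apply/rowP => i; rewrite mxE RRe_real //; exact: dr.
apply: le_trans (_ : \sum_i `|Re (d 0 i)| <= _); last first.
  by rewrite {1}eD'; exact: trnorm_spectral_ge.
rewrite -lecR rmorph_sum /=.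
apply: le_trans (_ : _ <= `|event_prob NK O bad K (sg - rho)|) _.
  apply: le_trans (normc_ge_Re _); rewrite lecR; exact: ler_norm.
rewrite {1}eD; apply: le_trans (positive_functional_bound _ epl _ VV) _.
  by move=> X pX; apply: (event_prob_itv (fun=> 0)).
by apply: ler_sum => i _; rewrite -norm_realC RRe_real.
Qed.

Lemma iter_state t rho : is_channel NK -> is_state rho ->
  is_state (iter t (kraus_map NK) rho).
Proof.
move=> cN srho; elim: t => [//|t [IHp IHt]]; rewrite iterS kraus_mapE; split.
  by apply: wkraus_hpsd => [u|]; [exact: ler01|exact: IHp].
by rewrite kraus_tr.
Qed.

End TrajectoryBridge.

(** * The stationary deviation bound and the conclusion *)

Lemma sample_size_bound (R : realFieldType) (W Cv g eps eta P : R) (K : nat) :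
  0 < W -> 0 < g -> 0 < eps -> 0 < eta -> (0 < K)%N ->
  2 * W / (eps ^+ 2 * eta) * (Cv / W / g + 1 / 2) <= K%:R ->
  (K%:R * eps) ^+ 2 * P <= K%:R * (W + 2 * (Cv / g)) -> P <= eta.
Proof.
move=> W0 g0 eps0 eta0 K0 hK h.
have KR : 0 < K%:R :> R by rewrite ltr0n.
have K2 : 0 < (K%:R * eps) ^+ 2 by rewrite exprn_gt0 // mulr_gt0.
rewrite -(ler_pM2l K2); apply: le_trans h _.
(* Thus the sample size condition says that [W + 2 * (Cv / g)] is at most
   [K%:R * (eps ^+ 2 * eta)]. *)
have e1 : W + 2 * (Cv / g) =
    2 * W / (eps ^+ 2 * eta) * (Cv / W / g + 1 / 2) * (eps ^+ 2 * eta).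
  by field; rewrite !gt_eqF.
have -> : (K%:R * eps) ^+ 2 * eta = K%:R * (K%:R * (eps ^+ 2 * eta)) by ring.
by rewrite ler_pM2l // e1 ler_pM2r // mulr_gt0 // exprn_gt0.
Qed.

(** Chebyshev at the threshold [K%:R * eps] for the process started in the Gibbs state, with
    [moment2_bound] at [lam = 1 - gap]. *)
Lemma single_trajectory_bound (R : realType) (N : nat) (beta : R)
  (U : 'M[R[i]]_N) (lam : 'I_N -> R) (s : R)
  (kN : nat) (NK : 'I_kN -> 'M[R[i]]_N)
  (m : nat) (val : 'I_m -> R) (O : 'I_m -> 'M[R[i]]_N)
  (eps eta : R) (K : nat) (rhob := gibbs beta U lam) :
  (0 < N)%N -> unitary_mx U -> is_channel NK -> is_channel O ->
  detailed_balance beta U lam s (kraus_dual NK) ->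
  detailed_balance beta U lam s (kraus_dual O) ->
  unique_fixed_state (kraus_map NK) rhob ->
  spectrum_in_01 (kraus_map NK) ->
  detailed_balance beta U lam s (hat_dual val O rhob) ->
  0 < meas_var val O rhob -> 0 < eps -> 0 < eta -> (0 < K)%N ->
  2 * meas_var val O rhob / (eps ^+ 2 * eta) *
    (meas_cov val O rhob / meas_var val O rhob
       / gap beta U lam s (kraus_dual NK) + 1 / 2) <= K%:R ->
  complex.Re (event_prob NK O
    (fun w => K%:R * eps <= `|\sum_(x <- w) (val x - meas_mean val O rhob)|) K rhob)
  <= eta.
Proof.
move=> N0 uU cN cO dbN dbO uniq spec dbH V0 eps0 eta0 K0 hK.
have Ke0 : 0 <= K%:R * eps by rewrite mulr_ge0 ?ler0n // ltW.
have sqr_le (t y : R) : 0 <= t -> t <= `|y| -> t ^+ 2 <= y ^+ 2.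
  by move=> t0 ty; rewrite -[leRHS]real_normK ?num_real // lerXn2r // nnegrE.
have hL := gibbs_pow_herm beta U lam ((1 - s) / 2).
have hR := gibbs_pow_herm beta U lam (s / 2).
have hQ := gibbs_pow_herm beta U lam 2^-1.
have uL := gibbs_pow_unit beta lam uU N0 ((1 - s) / 2).
have uR := gibbs_pow_unit beta lam uU N0 (s / 2).
have uQ := gibbs_pow_unit beta lam uU N0 2^-1.
have gamQ := gam_gibbs beta lam uU N0 s.
have rhoE := gibbs_sqr beta lam uU N0.
have gamE := etrans gamQ rhoE.
set Lh := gibbs_pow _ _ _ _ in hL uL gamQ gamE.
set Rh := gibbs_pow _ _ _ (s / 2) in hR uR gamQ gamE.
pose a x := ((val x - meas_mean val O rhob)%:C)%C : R[i].
have a_real x : a x \is Num.real by rewrite complex_real.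
have saN X Y : wip Lh Rh X (wkraus_dual NK (fun=> 1) Y) =
    wip Lh Rh (wkraus_dual NK (fun=> 1) X) Y.
  by rewrite -!kraus_dualE; exact: detailed_balance_wip.
have saM X Y : wip Lh Rh X (wkraus_dual O (fun=> 1) Y) =
    wip Lh Rh (wkraus_dual O (fun=> 1) X) Y.
  by rewrite -!kraus_dualE; exact: detailed_balance_wip.
have saH X Y : wip Lh Rh X (wkraus_dual O a Y) = wip Lh Rh (wkraus_dual O a X) Y.
  exact: (detailed_balance_wip uU N0 dbH).
have [g0 g1 conN] := gap_spec uU N0 cN dbN uniq spec.
have conM := channel_dual_contract hL hR hQ uL uR uQ cO gamQ saM.
have st : is_state rhob by case: uniq.
set g := gap _ _ _ _ _ in hK g0 g1 conN.
set W := meas_var _ _ _ in V0 hK.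
set Cv := meas_cov _ _ _ in hK.
have l0 : 0 <= ((1 - g)%:C)%C :> R[i] by rewrite ler0c subr_ge0.
have l1 : ((1 - g)%:C)%C < 1 :> R[i] by rewrite -[X in _ < X]/((1%:C)%C) ltcR gtrBl.
have cent : \tr (wkraus O a (gam Lh Rh 1%:M)) = 0.
  by rewrite gamE; exact: hat_centered.
have m2 := moment2_bound cN cO hL hR uL uR saN saM saH l0 l1 conM conN cent K.
have AE : wip Lh Rh (wkraus_dual O a 1%:M) (wkraus_dual O a 1%:M) = (Cv%:C)%C.
  rewrite [LHS]ge0_ReE; last exact: wip_ge0.
  by rewrite -(hat_hat_tr saH) gamE -meas_covE.
move: m2; rewrite AE gamE -!complexRe -meas_varE -/W => m2.
have {}m2 : complex.Re (wmoment (tstep NK O) a 2 K rhob) <= K%:R * (W + 2 * (Cv / g)).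
  rewrite -lecR; apply: le_trans m2 _.
  rewrite le_eqVlt; apply/orP; left; apply/eqP.
  have -> : 1 - ((1 - g)%:C)%C = (g%:C)%C :> R[i].
    by rewrite rmorphB /= opprB addrC subrK.
  have CM (x y : R) : ((x * y)%:C)%C = (x%:C)%C * (y%:C)%C :> R[i] by exact: rmorphM.
  have CD (x y : R) : ((x + y)%:C)%C = (x%:C)%C + (y%:C)%C :> R[i] by exact: rmorphD.
  have CV (x : R) : ((x^-1)%:C)%C = ((x%:C)%C)^-1 :> R[i] by exact: fmorphV.
  have Cn n : ((n%:R : R)%:C)%C = n%:R :> R[i] by exact: rmorph_nat.
  by rewrite CM CD 2!CM CV !Cn.
have t0 : 0 <= ((K%:R * eps)%:C)%C :> R[i].
  by rewrite ler0c; exact: Ke0.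
set bad := fun w : seq 'I_m => _.
have cheb : forall w, bad w -> (((K%:R * eps)%:C)%C) ^+ 2 <= wscore a w ^+ 2.
  move=> w bw; have -> : wscore a w =
      ((\sum_(x <- w) (val x - meas_mean val O rhob))%:C)%C.
    by rewrite rmorph_sum.
  by rewrite -!rmorphXn lecR; exact: sqr_le.
have psd_rho : hpsd rhob by case: st.
have := event_prob_chebyshev NK O a_real K psd_rho t0 cheb.
move=> /le_Re; rewrite -rmorphXn Re_realM => h.
have {}h := le_trans h m2.
exact: (sample_size_bound V0 g0 eps0 eta0 K0 hK h).
Qed.

Theorem theorem5p7 (R : realType) (n : nat)
  (H : 'M[R[i]]_(2 ^ n)%N) (beta : R)
  (U : 'M[R[i]]_(2 ^ n)%N) (lam : 'I_(2 ^ n)%N -> R)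
  (s : R)
  (kN : nat) (NK : 'I_kN -> 'M[R[i]]_(2 ^ n)%N)
  (m : nat) (val : 'I_m -> R) (O : 'I_m -> 'M[R[i]]_(2 ^ n)%N)
  (rho : 'M[R[i]]_(2 ^ n)%N) (eps eta : R) (Tburn K : nat) :
  herm_mx H -> unitary_mx U -> H = fcalc U lam id -> 0 < beta ->
  0 <= s <= 1 ->
  is_channel NK -> is_measurement val O ->
  detailed_balance beta U lam s (kraus_dual NK) ->
  detailed_balance beta U lam s (kraus_dual O) ->
  unique_fixed_state (kraus_map NK) (gibbs beta U lam) ->
  spectrum_in_01 (kraus_map NK) ->
  detailed_balance beta U lam s (hat_dual val O (gibbs beta U lam)) ->
  0 < meas_var val O (gibbs beta U lam) ->
  is_state rho -> 0 < eps -> 0 < eta ->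
  is_tmix (kraus_map NK) (gibbs beta U lam) eta Tburn ->
  (0 < K)%N ->
  2 * meas_var val O (gibbs beta U lam) / (eps ^+ 2 * eta) *
    (meas_cov val O (gibbs beta U lam) / meas_var val O (gibbs beta U lam)
       / gap beta U lam s (kraus_dual NK) + 1 / 2) <= K%:R ->
  alg_dev_prob NK val O rho Tburn K (meas_mean val O (gibbs beta U lam)) eps
    <= 2 * eta.
Proof.
move=> _ uU _ _ _ cN [_ cO] dbN dbO uniq spec dbH V0 srho eps0 eta0 [mix _] K0 hK.
have N0 : (0 < 2 ^ n)%N by rewrite expn_gt0.
have st : is_state (gibbs beta U lam) by case: uniq.
rewrite (alg_dev_probE NK val O rho Tburn _ eps K0).
apply: le_trans (event_prob_trnorm _ K cN cO (iter_state Tburn cN srho) st) _.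
(* One [eta] pays for the stationary deviation, the other for the distance remaining after the
   burn-in. *)
rewrite [leRHS]mulr_natl mulr2n; apply: lerD; last exact: mix.
exact: (single_trajectory_bound N0 uU cN cO dbN dbO uniq spec dbH V0 eps0 eta0 K0 hK).
Qed.
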